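(* Let $k$ be an algebraically closed field. For a pivotal finite tensor category $\mathcal{C}$ over $k$, the following are equivalent: (1) $\mathcal{C}$ is unimodular, that is, there is an isomorphism $\alpha_{\mathcal{C}}\cong\mathbb{1}$ in $\mathcal{C}$. (2) There is a non-zero right modified trace on $\mathrm{Proj}(\mathcal{C})$. (3) There is a non-zero left modified trace on $\mathrm{Proj}(\mathcal{C})$. If these equivalent conditions are satisfied, then $\dim_k\mathcal{T}^{(r)}_{\mathcal{C}}=\dim_k\mathcal{T}^{(\ell)}_{\mathcal{C}}=1$, where $\mathcal{T}^{(r)}_{\mathcal{C}}$ and $\mathcal{T}^{(\ell)}_{\mathcal{C}}$ are the spaces of right and left modified traces on $\mathrm{Proj}(\mathcal{C})$, and every non-zero left or right modified trace on $\mathrm{Proj}(\mathcal{C})$ is non-degenerate.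
   Context: A finite abelian category is a $k$-linear category equivalent to the category of finite-dimensional left modules over a finite-dimensional $k$-algebra. A finite tensor category is a finite abelian category $\mathcal{C}$ that is a rigid monoidal category (assumed strict) with $k$-bilinear tensor product and simple unit object $\mathbb{1}$. $\mathrm{Proj}(\mathcal{C})$ is the full subcategory of projective objects. $X^*$ is the left dual of $X$ with $\mathrm{ev}_X:X^*\otimes X\to\mathbb{1}$, $\mathrm{coev}_X:\mathbb{1}\to X\otimes X^*$; ${}^*X$ is the right dual with $\mathrm{ev}'_X:X\otimes{}^*X\to\mathbb{1}$, $\mathrm{coev}'_X:\mathbb{1}\to{}^*X\otimes X$. The duality functors are assumed strict monoidal and mutually inverse. A pivotal structure is an isomorphism $\mathfrak{p}:\mathrm{id}_{\mathcal{C}}\to(-)^{**}$ of monoidal functors; pivotal means equipped with one. An $\mathrm{id}_{\mathcal{C}}$-twisted trace on $\mathrm{Proj}(\mathcal{C})$ is a family of $k$-linear maps $\mathtt{t}_P:\mathrm{Hom}_{\mathcal{C}}(P,P)\to k$ ($P$ projective) with $\mathtt{t}_P(gf)=\mathtt{t}_Q(fg)$ for all $f:P\to Q$, $g:Q\to P$ between projectives. It is non-degenerate if the pairing $\mathrm{Hom}_{\mathcal{C}}(M,P)\times\mathrm{Hom}_{\mathcal{C}}(P,M)\to k$, $(f,g)\mapsto\mathtt{t}_P(fg)$, is non-degenerate for all $M\in\mathcal{C}$ and $P\in\mathrm{Proj}(\mathcal{C})$. It is a right modified trace if $\mathtt{t}_P\big((\mathrm{id}_P\otimes\mathrm{ev}_{X^*})(f\otimes\mathrm{id}_{X^*})(\mathrm{id}_P\otimes\mathrm{coev}_X)\big)=\mathtt{t}_{P\otimes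 X}\big((\mathrm{id}_P\otimes\mathfrak{p}_X^{-1})f\big)$ for all projective $P$, $X\in\mathcal{C}$, $f:P\otimes X\to P\otimes X^{**}$. It is a left modified trace if $\mathtt{t}_P\big((\mathrm{ev}'_{{}^*X}\otimes\mathrm{id}_P)(\mathrm{id}_{{}^*X}\otimes f)(\mathrm{coev}'_X\otimes\mathrm{id}_P)\big)=\mathtt{t}_{X\otimes P}\big((\mathfrak{p}_{{}^{**}X}\otimes\mathrm{id}_P)f\big)$ for all projective $P$, $X\in\mathcal{C}$, $f:X\otimes P\to{}^{**}X\otimes P$. For a finite-dimensional vector space $V$ and $M\in\mathcal{C}$, $V\cdot M$ is the object with $\mathrm{Hom}_{\mathcal{C}}(V\cdot M,N)\cong\mathrm{Hom}_k(V,\mathrm{Hom}_{\mathcal{C}}(M,N))$ naturally, and $\alpha_{\mathcal{C}}=\mathbb{N}_{\mathcal{C}}(\mathbb{1})=\int^{X\in\mathcal{C}}\mathrm{Hom}_{\mathcal{C}}(\mathbb{1},X)^*\cdot X$, where $\mathbb{N}_{\mathcal{C}}$ is the Nakayama functor. *)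

(* Defs.v *)
From Stdlib Require Import ProofIrrelevance.
From HB Require Import structures.
From mathcomp Require Import all_boot all_order all_algebra all_field.

Set Implicit Arguments.
Unset Strict Implicit.
Unset Printing Implicit Defensive.

Import GRing.Theory.
Local Open Scope ring_scope.

Reserved Notation "g \c f" (at level 40, left associativity).
Reserved Notation "X \ox Y" (at level 39, left associativity).
Reserved Notation "f \om g" (at level 39, left associativity).


(* Hom spaces are finite-dimensional: only categories equivalent to finite-
   dimensional modules over a finite-dimensional algebra are considered. *)
Record klincat (k : fieldType) := KLinCat {
  ob :> Type;
  Hom : ob -> ob -> vectType k;
  idm : forall X, Hom X X;
  hcomp : forall X Y Z, Hom Y Z -> Hom X Y -> Hom X Z;
  hcompA : forall W X Y Z (h : Hom Y Z) (g : Hom X Y) (f : Hom W X),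
    hcomp h (hcomp g f) = hcomp (hcomp h g) f;
  hcomp1m : forall X Y (f : Hom X Y), hcomp (idm Y) f = f;
  hcompm1 : forall X Y (f : Hom X Y), hcomp f (idm X) = f;
  hcomp_linearl : forall X Y Z (f : Hom X Y),
    linear ((fun g => hcomp g f) : Hom Y Z -> Hom X Z);
  hcomp_linearr : forall X Y Z (g : Hom Y Z),
    linear ((fun f => hcomp g f) : Hom X Y -> Hom X Z)
}.
Arguments Hom {k k0} X Y : rename.
Arguments idm {k k0} X : rename.
Arguments hcomp {k k0 X Y Z} g f : rename.
Notation "g \c f" := (hcomp g f) : ring_scope.

Section Morphisms.
Variables (k : fieldType) (C : klincat k).
Implicit Types X Y P : C.

Definition is_mono X Y (i : Hom X Y) :=
  forall W (u v : Hom W X), i \c u = i \c v -> u = v.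
Definition is_epi X Y (e : Hom X Y) :=
  forall Z (u v : Hom Y Z), u \c e = v \c e -> u = v.
Definition is_iso X Y (f : Hom X Y) :=
  exists g : Hom Y X, g \c f = idm X /\ f \c g = idm Y.
Definition isomorphic X Y := exists f : Hom X Y, is_iso f.

Definition is_zero X := idm X = 0.
Definition is_simple X :=
  ~ is_zero X /\
  forall S (i : Hom S X), is_mono i -> is_zero S \/ is_iso i.
Definition projective P :=
  forall X Y (e : Hom X Y) (f : Hom P Y), is_epi e ->
  exists g : Hom P X, e \c g = f.

(* Identity morphism along an equality of objects. *)
Definition eqhom X Y (e : X = Y) : Hom X Y :=
  match e in _ = Z return Hom X Z with erefl => idm X end.

Definition postcomp X Y Z (g : Hom Y Z) : 'Hom(Hom X Y, Hom X Z) :=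
  linfun (fun f => g \c f).
Definition precomp X Y Z (f : Hom X Y) : 'Hom(Hom Y Z, Hom X Z) :=
  linfun (fun g => g \c f).
End Morphisms.
Arguments eqhom {k C X Y} e.
Arguments postcomp {k C X Y Z} g.
Arguments precomp {k C X Y Z} f.

Section CompLemmas.
Variables (k : fieldType) (C : klincat k).

Lemma postcompE (X Y Z : C) (g : Hom Y Z) (f : Hom X Y) : postcomp g f = g \c f.
Proof.
pose L := GRing.isLinear.Build k _ _ _ _ (@hcomp_linearr k C X Y Z g).
pose h : {linear Hom X Y -> Hom X Z} := HB.pack (fun f : Hom X Y => g \c f) L.
exact: (lfunE h f).
Qed.

Lemma precompE (X Y Z : C) (f : Hom X Y) (g : Hom Y Z) : precomp f g = g \c f.
Proof.
pose L := GRing.isLinear.Build k _ _ _ _ (@hcomp_linearl k C X Y Z f).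
pose h : {linear Hom Y Z -> Hom X Z} := HB.pack (fun g : Hom Y Z => g \c f) L.
exact: (lfunE h g).
Qed.
End CompLemmas.

Record functor (k : fieldType) (C D : klincat k) := Functor {
  fob :> C -> D;
  fmap : forall X Y : C, Hom X Y -> Hom (fob X) (fob Y);
  fmap_linear : forall X Y : C, linear (@fmap X Y);
  fmap1 : forall X : C, fmap (idm X) = idm (fob X);
  fmapM : forall (X Y Z : C) (g : Hom Y Z) (f : Hom X Y),
    fmap (g \c f) = fmap g \c fmap f
}.
Arguments fmap {k C D} F {X Y} f : rename.

Definition equivalent (k : fieldType) (C D : klincat k) : Prop :=
  exists (F : functor C D) (G : functor D C)
    (eta : forall X : C, Hom X (G (F X)))
    (eps : forall Y : D, Hom (F (G Y)) Y),
  [/\ forall X Y (f : Hom X Y), eta Y \c f = fmap G (fmap F f) \c eta X,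
      forall X, is_iso (eta X),
      forall X Y (f : Hom X Y), f \c eps X = eps Y \c fmap F (fmap G f)
    & forall Y, is_iso (eps Y)].


Section Modules.
Variables (k : fieldType) (A : falgType k).

Record fdmod := FdMod {
  fdmod_sort :> vectType k;
  fdact : {linear A -> 'End(fdmod_sort)};
  fdact1 : fdact 1 = \1%VF;
  fdactM : forall a b, fdact (a * b) = (fdact a \o fdact b)%VF
}.
Implicit Types U V W : fdmod.

Definition act_defect V W (f : 'Hom(V, W)) : 'Hom(A, 'Hom(V, W)) :=
  linfun (fun a => ((f \o fdact V a) - (fdact W a \o f))%VF).
Definition modhom V W : {vspace 'Hom(V, W)} := lker (linfun (@act_defect V W)).

Lemma modhomP V W (f : 'Hom(V, W)) :
  reflect (forall a v, f (fdact V a v) = fdact W a (f v)) (f \in modhom V W).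
Proof.
have ev (g : 'Hom(V, W)) a v :
    ((g \o fdact V a) - (fdact W a \o g))%VF v = g (fdact V a v) - fdact W a (g v).
  by rewrite add_lfunE opp_lfunE !comp_lfunE.
have dE (g : 'Hom(V, W)) a :
    act_defect g a = ((g \o fdact V a) - (fdact W a \o g))%VF.
  have lin : linear (fun a => ((g \o fdact V a) - (fdact W a \o g))%VF).
    move=> c x y; apply/lfunP=> v.
    rewrite [RHS]add_lfunE scale_lfunE !ev.
    rewrite [fdact V _]linearP [fdact W _]linearP !(add_lfunE, scale_lfunE).
    by rewrite linearP scalerBr opprD addrACA.
  pose L := GRing.isLinear.Build k _ _ _ _ lin.
  pose h : {linear A -> 'Hom(V, W)} :=
    HB.pack (fun a : A => ((g \o fdact V a) - (fdact W a \o g))%VF) L.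
  exact: (lfunE h a).
have dlin : linear (@act_defect V W).
  move=> c x y; apply/lfunP=> a; rewrite [RHS]add_lfunE scale_lfunE !dE.
  apply/lfunP=> v; rewrite [RHS]add_lfunE scale_lfunE !ev.
  rewrite !(add_lfunE, scale_lfunE).
  by rewrite linearP scalerBr opprD addrACA.
pose L := GRing.isLinear.Build k _ _ _ _ dlin.
pose h : {linear 'Hom(V, W) -> 'Hom(A, 'Hom(V, W))} :=
  HB.pack (@act_defect V W) L.
rewrite memv_ker (lfunE h f) /=.
apply: (iffP eqP) => [f0 a v | fA].
  have /lfunP/(_ v) : act_defect f a = 0 by rewrite f0 lfunE.
  by rewrite dE ev zero_lfunE => /eqP; rewrite subr_eq0 => /eqP.
apply/lfunP=> a; rewrite dE zero_lfunE; apply/lfunP=> v.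
by rewrite ev fA subrr zero_lfunE.
Qed.

Definition modHom V W : vectType k := subvs_of (modhom V W).

Lemma modhom1 V : \1%VF \in modhom V V.
Proof. by apply/modhomP=> a v; rewrite !lfunE. Qed.

Lemma modhomM U V W (g : modHom V W) (f : modHom U V) :
  (vsval g \o vsval f)%VF \in modhom U W.
Proof.
apply/modhomP=> a v; rewrite !lfunE /=.
by rewrite (modhomP _ (subvsP f)) (modhomP _ (subvsP g)).
Qed.

Definition modId V : modHom V V := Subvs (modhom1 V).
Definition modComp U V W (g : modHom V W) (f : modHom U V) : modHom U W :=
  Subvs (modhomM g f).

Lemma modCompA U V W Z (h : modHom W Z) (g : modHom V W) (f : modHom U V) :
  modComp h (modComp g f) = modComp (modComp h g) f.
Proof. by apply: val_inj; rewrite /= comp_lfunA. Qed.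

Lemma modComp1m V W (f : modHom V W) : modComp (modId W) f = f.
Proof. by apply: val_inj; rewrite /= comp_lfun1l. Qed.

Lemma modCompm1 V W (f : modHom V W) : modComp f (modId V) = f.
Proof. by apply: val_inj; rewrite /= comp_lfun1r. Qed.

Lemma modComp_linearl U V W (f : modHom U V) :
  linear ((fun g => modComp g f) : modHom V W -> modHom U W).
Proof.
move=> c g h; apply: val_inj; apply/lfunP=> v.
rewrite [in RHS](linearP (@vsval _ _ _)) /= add_lfunE scale_lfunE !comp_lfunE.
have E : vsval (c *: g + h) = c *: vsval g + vsval h by exact: linearP.
by move/lfunP: E => ->; rewrite add_lfunE scale_lfunE.
Qed.

Lemma modComp_linearr U V W (g : modHom V W) :
  linear ((fun f => modComp g f) : modHom U V -> modHom U W).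
Proof.
move=> c f h; apply: val_inj; apply/lfunP=> v.
rewrite [in RHS](linearP (@vsval _ _ _)) /= add_lfunE scale_lfunE !comp_lfunE.
have E : vsval (c *: f + h) = c *: vsval f + vsval h by exact: linearP.
by move/lfunP: E => ->; rewrite add_lfunE scale_lfunE linearP.
Qed.

Definition fdmod_cat : klincat k :=
  KLinCat modCompA modComp1m modCompm1 modComp_linearl modComp_linearr.
End Modules.

(* An [falgType] is non-zero; this only excludes the zero category, which has
   no simple object. *)
Definition finite_abelian (k : fieldType) (C : klincat k) : Prop :=
  exists A : falgType k, equivalent C (fdmod_cat A).


Section Copower.
Variables (k : fieldType) (C : klincat k).

Record copower (V : vectType k) (M : C) := Copower {
  cp_ob :> C;
  cp_hom : forall N : C, Hom cp_ob N -> 'Hom(V, Hom M N);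
  cp_inv : forall N : C, 'Hom(V, Hom M N) -> Hom cp_ob N;
  cp_homK : forall N : C, cancel (@cp_hom N) (@cp_inv N);
  cp_invK : forall N : C, cancel (@cp_inv N) (@cp_hom N);
  cp_nat : forall (N N' : C) (g : Hom N N') (h : Hom cp_ob N),
    cp_hom (g \c h) = (postcomp g \o cp_hom h)%VF
}.

Definition cp_unit V M (T : copower V M) : 'Hom(V, Hom M T) :=
  cp_hom (idm (cp_ob T)).

(* Functoriality of [V . M] in [V] and [M]. *)
Definition cp_map V V' (M M' : C) (T : copower V M) (T' : copower V' M')
    (phi : 'Hom(V, V')) (g : Hom M M') : Hom T T' :=
  cp_inv T (precomp g \o (cp_unit T' \o phi))%VF.

Lemma cp_homE V M (T : copower V M) (N : C) (h : Hom T N) v :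
  cp_hom h v = h \c cp_unit T v.
Proof. by rewrite -{1}(hcompm1 h) cp_nat comp_lfunE postcompE. Qed.

Lemma cp_homP V M (T : copower V M) (N : C) (h h' : Hom T N) :
  (forall v, h \c cp_unit T v = h' \c cp_unit T v) -> h = h'.
Proof.
move=> e; apply: (can_inj (@cp_homK _ _ T N)); apply/lfunP=> v.
by rewrite (cp_homE h) (cp_homE h') e.
Qed.

Lemma cp_mapE V V' M M' (T : copower V M) (T' : copower V' M')
    (phi : 'Hom(V, V')) (g : Hom M M') v :
  cp_map T T' phi g \c cp_unit T v = cp_unit T' (phi v) \c g.
Proof. by rewrite -cp_homE cp_invK !comp_lfunE precompE. Qed.

Lemma cp_map1 V M (T : copower V M) : cp_map T T \1%VF (idm M) = idm (cp_ob T).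
Proof. by apply: cp_homP => v; rewrite cp_mapE id_lfunE hcomp1m hcompm1. Qed.

Lemma cp_mapM V V' V'' M M' M'' (T : copower V M) (T' : copower V' M')
    (T'' : copower V'' M'') (psi : 'Hom(V', V'')) (phi : 'Hom(V, V'))
    (g' : Hom M' M'') (g : Hom M M') :
  cp_map T' T'' psi g' \c cp_map T T' phi g =
  cp_map T T'' (psi \o phi)%VF (g' \c g).
Proof.
apply: cp_homP => v.
by rewrite -hcompA !cp_mapE comp_lfunE hcompA cp_mapE hcompA.
Qed.

(* Functors [C^op x C -> C]; contravariant in the first variable. *)
Record bifunctor := Bifunctor {
  bf_ob :> C -> C -> C;
  bf_map : forall X X' Y Y' : C,
    Hom X' X -> Hom Y Y' -> Hom (bf_ob X Y) (bf_ob X' Y');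
  bf_map1 : forall X Y, bf_map (idm X) (idm Y) = idm (bf_ob X Y);
  bf_mapM : forall (X X' X'' Y Y' Y'' : C) (f : Hom X' X) (f' : Hom X'' X')
      (g' : Hom Y' Y'') (g : Hom Y Y'),
    bf_map (f \c f') (g' \c g) = bf_map f' g' \c bf_map f g
}.

Definition dinatural (S : bifunctor) (T : C) (i : forall X, Hom (S X X) T) :=
  forall (X Y : C) (f : Hom X Y),
    i X \c bf_map S f (idm X) = i Y \c bf_map S (idm Y) f.

Definition is_coend (S : bifunctor) (T : C) : Prop :=
  exists i : forall X, Hom (S X X) T, dinatural i /\
    forall (N : C) (j : forall X, Hom (S X X) N), dinatural j ->
    exists! h : Hom T N, forall X, h \c i X = j X.

Definition dual (V : vectType k) : vectType k := 'Hom(V, k^o).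
Definition transpose (V W : vectType k) (u : 'Hom(V, W)) :
    'Hom(dual W, dual V) :=
  linfun (fun phi : dual W => (phi \o u)%VF : dual V).

Lemma transposeE (V W : vectType k) (u : 'Hom(V, W)) (phi : dual W) :
  transpose u phi = (phi \o u)%VF.
Proof.
have lin : linear (fun phi : dual W => (phi \o u)%VF : dual V).
  by move=> c x y; rewrite /= comp_lfunDl comp_lfunZl.
pose L := GRing.isLinear.Build k _ _ _ _ lin.
pose h : {linear dual W -> dual V} :=
  HB.pack (fun phi : dual W => (phi \o u)%VF : dual V) L.
exact: (lfunE h phi).
Qed.

Variable cp : forall (V : vectType k) (M : C), copower V M.

Definition nakayama_map (M X X' Y Y' : C) (f : Hom X' X) (g : Hom Y Y') :
    Hom (cp (dual (Hom M X)) Y) (cp (dual (Hom M X')) Y') :=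
  cp_map _ _ (transpose (postcomp f)) g.

Lemma nakayama_map1 M X Y :
  nakayama_map M (idm X) (idm Y) = idm (cp_ob (cp (dual (Hom M X)) Y)).
Proof.
rewrite /nakayama_map -cp_map1; congr cp_map; apply/lfunP=> phi.
rewrite transposeE id_lfunE; apply/lfunP=> h.
by rewrite comp_lfunE postcompE hcomp1m.
Qed.

Lemma nakayama_mapM M (X X' X'' Y Y' Y'' : C) (f : Hom X' X) (f' : Hom X'' X')
    (g' : Hom Y' Y'') (g : Hom Y Y') :
  nakayama_map M (f \c f') (g' \c g) =
  nakayama_map M f' g' \c nakayama_map M f g.
Proof.
rewrite /nakayama_map cp_mapM; congr cp_map; apply/lfunP=> phi.
rewrite comp_lfunE !transposeE; apply/lfunP=> h.
by rewrite !comp_lfunE !postcompE hcompA.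
Qed.

(* [(X, Y) |-> Hom(M, X)^* . Y] *)
Definition nakayama_integrand (M : C) : bifunctor :=
  Bifunctor (nakayama_map1 M) (@nakayama_mapM M).

Definition is_nakayama (M N : C) : Prop := is_coend (nakayama_integrand M) N.
End Copower.


Record tensor_structure (k : fieldType) (C : klincat k) := TensorStructure {
  one : C;
  tens : C -> C -> C;
  tensm : forall X X' Y Y' : C,
    Hom X X' -> Hom Y Y' -> Hom (tens X Y) (tens X' Y');
  tensm_linearl : forall (X X' Y Y' : C) (g : Hom Y Y'),
    linear ((fun f => tensm f g) : Hom X X' -> Hom (tens X Y) (tens X' Y'));
  tensm_linearr : forall (X X' Y Y' : C) (f : Hom X X'),
    linear ((fun g => tensm f g) : Hom Y Y' -> Hom (tens X Y) (tens X' Y'));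
  tensm1 : forall X Y, tensm (idm X) (idm Y) = idm (tens X Y);
  tensmM : forall (X X' X'' Y Y' Y'' : C) (f' : Hom X' X'') (f : Hom X X')
      (g' : Hom Y' Y'') (g : Hom Y Y'),
    tensm (f' \c f) (g' \c g) = tensm f' g' \c tensm f g;
  tensA : forall X Y Z, tens (tens X Y) Z = tens X (tens Y Z);
  tens1X : forall X, tens one X = X;
  tensX1 : forall X, tens X one = X;
  tensmA : forall (X X' Y Y' Z Z' : C)
      (f : Hom X X') (g : Hom Y Y') (h : Hom Z Z'),
    eqhom (tensA X' Y' Z') \c tensm (tensm f g) h =
    tensm f (tensm g h) \c eqhom (tensA X Y Z);
  tensm1f : forall (X X' : C) (f : Hom X X'),
    eqhom (tens1X X') \c tensm (idm one) f = f \c eqhom (tens1X X);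
  tensmf1 : forall (X X' : C) (f : Hom X X'),
    eqhom (tensX1 X') \c tensm f (idm one) = f \c eqhom (tensX1 X)
}.

(* Strict monoidal; associators and unitors are the [eqhom] of object equalities. *)
Record tensorcat (k : fieldType) := TensorCat {
  tc_cat :> klincat k;
  tc_struct : tensor_structure tc_cat
}.
Definition unit_ob {k} (C : tensorcat k) : C := one (tc_struct C).
Arguments tensA {k C} t X Y Z : rename.
Notation "X \ox Y" := (tens (tc_struct _) X Y) : ring_scope.
Notation "f \om g" := (tensm (tc_struct _) f g) : ring_scope.

Section Duals.
Variables (k : fieldType) (C : tensorcat k).
Implicit Types X Y Z L : C.

Definition assoc X Y Z : Hom ((X \ox Y) \ox Z) (X \ox (Y \ox Z)) :=
  eqhom (tensA _ X Y Z).
Definition assocV X Y Z : Hom (X \ox (Y \ox Z)) ((X \ox Y) \ox Z) :=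
  eqhom (esym (tensA _ X Y Z)).
Definition lunit X : Hom (unit_ob C \ox X) X := eqhom (tens1X _ X).
Definition lunitV X : Hom X (unit_ob C \ox X) := eqhom (esym (tens1X _ X)).
Definition runit X : Hom (X \ox unit_ob C) X := eqhom (tensX1 _ X).
Definition runitV X : Hom X (X \ox unit_ob C) := eqhom (esym (tensX1 _ X)).

(* [L] is a left dual of [X]; equivalently [X] is a right dual of [L]. *)
Definition dual_pair L X (e : Hom (L \ox X) (unit_ob C))
    (c : Hom (unit_ob C) (X \ox L)) : Prop :=
  runit X \c (idm X \om e) \c assoc X L X \c (c \om idm X) \c lunitV X = idm X
  /\
  lunit L \c (e \om idm L) \c assocV L X L \c (idm L \om c) \c runitV L = idm L.
End Duals.

Record rigid_structure (k : fieldType) (C : tensorcat k) := RigidStructure {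
  ldual : C -> C;
  ev : forall X, Hom (ldual X \ox X) (unit_ob C);
  coev : forall X, Hom (unit_ob C) (X \ox ldual X);
  ldualP : forall X, dual_pair (ev X) (coev X);
  rdual : C -> C;
  ev' : forall X, Hom (X \ox rdual X) (unit_ob C);
  coev' : forall X, Hom (unit_ob C) (rdual X \ox X);
  rdualP : forall X, dual_pair (ev' X) (coev' X);
  (* The duality functors are strict monoidal: the canonical isomorphisms
     [1^* = 1] and [(X (x) Y)^* = Y^* (x) X^*], which are characterized by
     compatibility with the evaluations, are identities. *)
  ldual1 : ldual (unit_ob C) = unit_ob C;
  ev1 : ev (unit_ob C) = eqhom (etrans (tensX1 _ _) ldual1);
  ldualM : forall X Y, ldual (X \ox Y) = ldual Y \ox ldual X;
  evM : forall X Y, ev (X \ox Y) =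
    ev Y \c (idm (ldual Y) \om (lunit Y \c (ev X \om idm Y) \c assocV _ X Y))
      \c assoc (ldual Y) (ldual X) (X \ox Y)
      \c (eqhom (ldualM X Y) \om idm (X \ox Y));
  rdual1 : rdual (unit_ob C) = unit_ob C;
  ev'1 : ev' (unit_ob C) = eqhom (etrans (tens1X _ _) rdual1);
  rdualM : forall X Y, rdual (X \ox Y) = rdual Y \ox rdual X;
  ev'M : forall X Y, ev' (X \ox Y) =
    ev' X \c ((runit X \c (idm X \om ev' Y) \c assoc X Y _) \om idm (rdual X))
      \c assocV (X \ox Y) (rdual Y) (rdual X)
      \c (idm (X \ox Y) \om eqhom (rdualM X Y));
  (* They are mutually inverse: the canonical isomorphisms [^*(X^* ) = X] and
     [( ^*X)^* = X] are identities. *)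
  rldual : forall X, rdual (ldual X) = X;
  ev'_ldual : forall X, ev' (ldual X) = ev X \c (idm (ldual X) \om eqhom (rldual X));
  lrdual : forall X, ldual (rdual X) = X;
  ev_rdual : forall X, ev (rdual X) = ev' X \c (eqhom (lrdual X) \om idm (rdual X))
}.

Section Rigid.
Variables (k : fieldType) (C : tensorcat k) (D : rigid_structure C).
Implicit Types X Y Z P : C.

Definition lddual X : C := ldual D (ldual D X).
Definition rddual X : C := rdual D (rdual D X).

(* [f^* : Y^* -> X^*] *)
Definition ldual_map X Y (f : Hom X Y) : Hom (ldual D Y) (ldual D X) :=
  lunit _ \c (ev D Y \om idm (ldual D X)) \c assocV _ _ _
    \c (idm (ldual D Y) \om ((f \om idm (ldual D X)) \c coev D X)) \c runitV _.

Definition lddual_map X Y (f : Hom X Y) : Hom (lddual X) (lddual Y) :=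
  ldual_map (ldual_map f).

Lemma lddual1 : lddual (unit_ob C) = unit_ob C.
Proof. by rewrite /lddual !ldual1. Qed.

Lemma lddualM X Y : lddual (X \ox Y) = lddual X \ox lddual Y.
Proof. by rewrite /lddual !ldualM. Qed.

Lemma lrddual X : lddual (rddual X) = X.
Proof. by rewrite /lddual /rddual !lrdual. Qed.

Record pivotal_structure := PivotalStructure {
  piv : forall X, Hom X (lddual X);
  pivV : forall X, Hom (lddual X) X;
  pivK : forall X, pivV X \c piv X = idm X;
  pivVK : forall X, piv X \c pivV X = idm (lddual X);
  piv_nat : forall X Y (f : Hom X Y), piv Y \c f = lddual_map f \c piv X;
  piv1 : eqhom lddual1 \c piv (unit_ob C) = idm (unit_ob C);
  pivM : forall X Y, eqhom (lddualM X Y) \c piv (X \ox Y) = piv X \om piv Y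
}.
End Rigid.

Record finite_tensor_category (k : closedFieldType) := FiniteTensorCategory {
  ftc_cat :> tensorcat k;
  ftc_finite : finite_abelian ftc_cat;
  ftc_rigid : rigid_structure ftc_cat;
  ftc_simple : is_simple (unit_ob ftc_cat)
}.

Section Projectivity.
Variables (k : fieldType) (C : tensorcat k).
Implicit Types A B L P X Y Z W : C.

Lemma eqhom_irr X Y (e e' : X = Y) : eqhom e = eqhom e'.
Proof. by rewrite (proof_irrelevance _ e e'). Qed.

Lemma eqhomM X Y Z (e : X = Y) (e' : Y = Z) :
  eqhom e' \c eqhom e = eqhom (etrans e e').
Proof. by case: Z / e'; rewrite hcomp1m. Qed.

Lemma eqhomVK X Y (e : X = Y) : eqhom (esym e) \c eqhom e = idm X.
Proof. by rewrite eqhomM (eqhom_irr _ erefl). Qed.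

Lemma eqhom_tens X X' Y Y' (e : X = X') (e' : Y = Y') :
  eqhom e \om eqhom e' = eqhom (f_equal2 (tens (tc_struct C)) e e').
Proof. by subst X' Y'; rewrite tensm1 [RHS](eqhom_irr _ erefl). Qed.

Lemma tensmMl X X' X'' Y (f' : Hom X' X'') (f : Hom X X') :
  (f' \c f) \om idm Y = (f' \om idm Y) \c (f \om idm Y).
Proof. by rewrite -tensmM hcomp1m. Qed.

Lemma tensmMr X X' X'' Y (f' : Hom X' X'') (f : Hom X X') :
  idm Y \om (f' \c f) = (idm Y \om f') \c (idm Y \om f).
Proof. by rewrite -tensmM hcomp1m. Qed.

Lemma tensmAV (X X' Y Y' Z Z' : C) (f : Hom X X') (g : Hom Y Y')
    (h : Hom Z Z') :
  f \om (g \om h) = assoc X' Y' Z' \c ((f \om g) \om h) \c assocV X Y Z.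
Proof.
rewrite /assoc tensmA -hcompA /assocV eqhomM (eqhom_irr _ erefl).
by rewrite hcompm1.
Qed.

Lemma tensmVA (X X' Y Y' Z Z' : C) (f : Hom X X') (g : Hom Y Y')
    (h : Hom Z Z') :
  (f \om g) \om h = assocV X' Y' Z' \c (f \om (g \om h)) \c assoc X Y Z.
Proof. by rewrite -hcompA -[_ \c assoc _ _ _]tensmA hcompA eqhomVK hcomp1m. Qed.

Section Adjunction.
Variables (L X : C) (e : Hom (L \ox X) (unit_ob C)).
Variables (c : Hom (unit_ob C) (X \ox L)) (LX : dual_pair e c).

Definition curryr A B (f : Hom (A \ox X) B) : Hom A (B \ox L) :=
  (f \om idm L) \c (assocV A X L \c (idm A \om c) \c runitV A).
Definition uncurryr A B (g : Hom A (B \ox L)) : Hom (A \ox X) B :=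
  runit B \c (idm B \om e) \c assoc B L X \c (g \om idm X).
Definition curryl A B (f : Hom (L \ox A) B) : Hom A (X \ox B) :=
  (idm X \om f) \c (assoc X L A \c (c \om idm A) \c lunitV A).
Definition uncurryl A B (g : Hom A (X \ox B)) : Hom (L \ox A) B :=
  lunit B \c (e \om idm B) \c assocV L X B \c (idm L \om g).


Lemma curryrK A B : cancel (@curryr A B) (@uncurryr A B).
Proof.
move=> f; rewrite /uncurryr /curryr.
have e1 : assoc B L X \c (((f \om idm L)
     \c (assocV A X L \c (idm A \om c) \c runitV A)) \om idm X) =
  (f \om idm (L \ox X)) \c (assoc (A \ox X) L X
     \c ((assocV A X L \c (idm A \om c) \c runitV A) \om idm X)).
  by rewrite tensmMl hcompA [assoc B L X \c _]tensmA tensm1 hcompA.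
rewrite -hcompA e1 hcompA.
have e2 : runit B \c (idm B \om e) \c (f \om idm (L \ox X)) =
  f \c (runit (A \ox X) \c (idm (A \ox X) \om e)).
  rewrite -hcompA -tensmM hcomp1m hcompm1.
  have -> : f \om e = (f \om idm _) \c (idm _ \om e).
    by rewrite -tensmM hcomp1m hcompm1.
  by rewrite hcompA [runit B \c _]tensmf1 hcompA.
rewrite e2 -hcompA -[RHS]hcompm1; congr (_ \c _).

transitivity (idm A \om
  (runit X \c (idm X \om e) \c assoc X L X \c (c \om idm X) \c lunitV X)).
  rewrite !tensmMr !tensmMl -[idm (A \ox X)]tensm1 (tensmVA _ _ e) (tensmVA _ c).
  have i1 : runit (A \ox X) \c assocV A X (unit_ob C) = idm A \om runit X.
    by rewrite /runit -[idm A]/(eqhom erefl) eqhom_tens eqhomM; apply: eqhom_irr.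
  have i2 : assoc A (unit_ob C) X \c (runitV A \om idm X) = idm A \om lunitV X.
    rewrite -[idm A]/(eqhom erefl) -[idm X]/(eqhom erefl) !eqhom_tens eqhomM.
    exact: eqhom_irr.
  have i3 : assoc A X (L \ox X) \c (assoc (A \ox X) L X \c
      ((assocV A X L \om idm X) \c assocV A (X \ox L) X)) = idm A \om assoc X L X.
    rewrite -[idm A]/(eqhom erefl) -[idm X]/(eqhom erefl) !eqhom_tens !eqhomM.
    exact: eqhom_irr.
  by rewrite -i1 -i2 -i3 !hcompA.
by rewrite (proj1 LX) tensm1.
Qed.


Lemma curryr_comp A B B' (h : Hom B B') (f : Hom (A \ox X) B) :
  curryr (h \c f) = (h \om idm L) \c curryr f.
Proof. by rewrite /curryr tensmMl [RHS]hcompA. Qed.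

Lemma uncurryr_comp A B B' (h : Hom B B') (g : Hom A (B \ox L)) :
  uncurryr ((h \om idm L) \c g) = h \c uncurryr g.
Proof.
rewrite /uncurryr tensmMl hcompA; rewrite [in RHS]hcompA; congr (_ \c _).
rewrite -[LHS]hcompA [assoc _ _ _ \c _]tensmA tensm1 hcompA [RHS]hcompA.
congr (_ \c _); rewrite -[LHS]hcompA -tensmM hcomp1m hcompm1.
rewrite [RHS]hcompA -[h \c runit B]tensmf1 -[RHS]hcompA -tensmM.
by rewrite hcomp1m hcompm1.
Qed.

Lemma curryl_comp A B B' (h : Hom B B') (f : Hom (L \ox A) B) :
  curryl (h \c f) = (idm X \om h) \c curryl f.
Proof. by rewrite /curryl tensmMr [RHS]hcompA. Qed.

Lemma uncurryl_comp A B B' (h : Hom B B') (g : Hom A (X \ox B)) :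
  uncurryl ((idm X \om h) \c g) = h \c uncurryl g.
Proof.
rewrite /uncurryl tensmMr hcompA; rewrite [in RHS]hcompA; congr (_ \c _).
rewrite -[LHS]hcompA.
have -> : assocV L X B' \c (idm L \om (idm X \om h)) =
    (idm (L \ox X) \om h) \c assocV L X B.
  by rewrite tensmAV tensm1 !hcompA eqhomM (eqhom_irr _ erefl) hcomp1m.
rewrite hcompA [RHS]hcompA; congr (_ \c _).
rewrite -[LHS]hcompA -tensmM hcomp1m hcompm1.
rewrite [RHS]hcompA -[h \c lunit B]tensm1f -[RHS]hcompA -tensmM.
by rewrite hcomp1m hcompm1.
Qed.

Lemma currylK A B : cancel (@curryl A B) (@uncurryl A B).
Proof.
move=> f; rewrite /curryl uncurryl_comp -[RHS]hcompm1; congr (_ \c _).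
rewrite /uncurryl; transitivity ((lunit L \c (e \om idm L) \c assocV L X L
   \c (idm L \om c) \c runitV L) \om idm A).
  rewrite !tensmMr !tensmMl -[idm (L \ox A)]tensm1 (tensmAV e) (tensmAV _ c).
  have i1 : lunit (L \ox A) \c assoc (unit_ob C) L A = lunit L \om idm A.
    by rewrite /lunit -[idm A]/(eqhom erefl) eqhom_tens eqhomM; apply: eqhom_irr.
  have i2 : assocV L (unit_ob C) A \c (idm L \om lunitV A) = runitV L \om idm A.
    rewrite -[idm A]/(eqhom erefl) -[idm L]/(eqhom erefl) !eqhom_tens eqhomM.
    exact: eqhom_irr.
  have i3 : assocV (L \ox X) L A \c (assocV L X (L \ox A) \c
      ((idm L \om assoc X L A) \c assoc L (X \ox L) A)) = assocV L X L \om idm A.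
    rewrite -[idm A]/(eqhom erefl) -[idm L]/(eqhom erefl) !eqhom_tens !eqhomM.
    exact: eqhom_irr.
  by rewrite -i1 -i2 -i3 !hcompA.
by rewrite (proj2 LX) tensm1.
Qed.

Lemma curryr_precomp A A' B (f : Hom (A \ox X) B) (h : Hom A' A) :
  curryr (f \c (h \om idm X)) = curryr f \c h.
Proof.
rewrite /curryr tensmMl -[LHS]hcompA -[RHS]hcompA; congr (_ \c _).
have i1 : runitV A \c h = (h \om idm _) \c runitV A'.
  rewrite -[LHS]hcompm1 -[idm A'](_ : runit A' \c runitV A' = _); last first.
    by rewrite eqhomM (eqhom_irr _ erefl).
  by rewrite hcompA -[_ \c runit A']hcompA -[h \c _]tensmf1 !hcompA eqhomVK hcomp1m.
rewrite -[RHS]hcompA i1 [RHS]hcompA -[X in _ = X \c _]hcompA -tensmM hcomp1m hcompm1.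
have -> : h \om c = (h \om (idm X \om idm L)) \c (idm A' \om c).
  by rewrite tensm1 -tensmM hcomp1m hcompm1.
rewrite tensmAV -!hcompA (hcompA _ (assoc _ _ _)) eqhomVK hcomp1m.
by [].
Qed.

Lemma curryl_precomp A A' B (f : Hom (L \ox A) B) (h : Hom A' A) :
  curryl (f \c (idm L \om h)) = curryl f \c h.
Proof.
rewrite /curryl tensmMr -[LHS]hcompA -[RHS]hcompA; congr (_ \c _).
have i1 : lunitV A \c h = (idm _ \om h) \c lunitV A'.
  rewrite -[LHS]hcompm1 -[idm A'](_ : lunit A' \c lunitV A' = _); last first.
    by rewrite eqhomM (eqhom_irr _ erefl).
  by rewrite hcompA -[_ \c lunit A']hcompA -[h \c _]tensm1f !hcompA eqhomVK hcomp1m.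
rewrite -[RHS]hcompA i1 [RHS]hcompA -[X in _ = X \c _]hcompA -tensmM hcomp1m hcompm1.
have -> : c \om h = ((idm X \om idm L) \om h) \c (c \om idm A').
  by rewrite tensm1 -tensmM hcomp1m hcompm1.
rewrite tensmVA -!hcompA (hcompA _ (assocV _ _ _)) eqhomM (eqhom_irr _ erefl).
by rewrite hcomp1m.
Qed.
End Adjunction.


Lemma epi_tensr L X Y Z (e : Hom (L \ox X) (unit_ob C)) c (f : Hom Y Z) :
  dual_pair e c -> is_epi f -> is_epi (f \om idm X).
Proof.
move=> LX f_epi W u v uv; rewrite -(curryrK LX u) -(curryrK LX v).
by congr uncurryr; apply: f_epi; rewrite -!curryr_precomp uv.
Qed.

Lemma epi_tensl L X Y Z (e : Hom (L \ox X) (unit_ob C)) c (f : Hom Y Z) :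
  dual_pair e c -> is_epi f -> is_epi (idm L \om f).
Proof.
move=> LX f_epi W u v uv; rewrite -(currylK LX u) -(currylK LX v).
by congr uncurryl; apply: f_epi; rewrite -!curryl_precomp uv.
Qed.
End Projectivity.

Section TensorProjective.
Variables (k : fieldType) (C : tensorcat k) (D : rigid_structure C).

Lemma projective_tensr (P X : C) : projective P -> projective (P \ox X).
Proof.
move=> P_proj Y Z p f p_epi.
have [g gE] := P_proj _ _ _ (curryr (coev D X) f)
  (epi_tensr (ldualP D (ldual D X)) p_epi).
exists (uncurryr (ev D X) g).
by rewrite -uncurryr_comp gE (curryrK (ldualP D X)).
Qed.

Lemma projective_tensl (P X : C) : projective P -> projective (X \ox P).
Proof.
move=> P_proj Y Z p f p_epi.
have [g gE] := P_proj _ _ _ (curryl (coev' D X) f)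
  (epi_tensl (rdualP D (rdual D X)) p_epi).
exists (uncurryl (ev' D X) g).
by rewrite -uncurryl_comp gE (currylK (rdualP D X)).
Qed.
End TensorProjective.

Record pivotal_ftc (k : closedFieldType) := PivotalFTC {
  pftc_cat :> finite_tensor_category k;
  pftc_piv : pivotal_structure (ftc_rigid pftc_cat)
}.

(* The copowers and the coend [alpha] exist in a finite abelian category and are
   unique up to isomorphism, so their choice is immaterial. *)
Definition unimodular (k : closedFieldType) (C : finite_tensor_category k) :
    Prop :=
  exists (cp : forall (V : vectType k) (M : C), copower V M) (alpha : C),
    is_nakayama cp (unit_ob C) alpha /\ isomorphic alpha (unit_ob C).


Section Traces.
Variables (k : closedFieldType) (C : pivotal_ftc k).
Local Notation D := (ftc_rigid C).

Record Proj := MkProj { pr_ob :> C; prP : projective pr_ob }.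

Definition projr (P : Proj) (X : C) : Proj :=
  MkProj (@projective_tensr _ _ D P X (@prP P)).
Definition projl (X : C) (P : Proj) : Proj :=
  MkProj (@projective_tensl _ _ D P X (@prP P)).

Definition trace_family := forall P : Proj, 'Hom(Hom P P, k^o).
Implicit Types t : trace_family.

Definition is_trace t : Prop :=
  forall (P Q : Proj) (f : Hom P Q) (g : Hom Q P), t P (g \c f) = t Q (f \c g).

Definition nonzero_trace t : Prop := exists P f, t P f != 0.

Definition nondegenerate_trace t : Prop :=
  forall (M : C) (P : Proj),
    (forall f : Hom M P, (forall g : Hom P M, t P (f \c g) = 0) -> f = 0) /\
    (forall g : Hom P M, (forall f : Hom M P, t P (f \c g) = 0) -> g = 0).

Definition right_partial_trace (P X : C) (f : Hom (P \ox X) (P \ox lddual D X)) :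
    Hom P P :=
  runit P \c (idm P \om ev D (ldual D X)) \c assoc P (lddual D X) (ldual D X)
    \c (f \om idm (ldual D X))
    \c assocV P X (ldual D X) \c (idm P \om coev D X) \c runitV P.

Definition left_partial_trace (P X : C) (f : Hom (X \ox P) (rddual D X \ox P)) :
    Hom P P :=
  lunit P \c (ev' D (rdual D X) \om idm P) \c assocV (rdual D X) (rddual D X) P
    \c (idm (rdual D X) \om f)
    \c assoc (rdual D X) X P \c (coev' D X \om idm P) \c lunitV P.

(* [p_{**X} : **X -> ( **X)** = X] *)
Definition piv_rddual (X : C) : Hom (rddual D X) X :=
  eqhom (lrddual D X) \c piv (pftc_piv C) (rddual D X).

Definition right_modified_trace t : Prop :=
  is_trace t /\
  forall (P : Proj) (X : C) (f : Hom (P \ox X) (P \ox lddual D X)),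
    t P (right_partial_trace f) =
    t (projr P X) ((idm P \om pivV (pftc_piv C) X) \c f).

Definition left_modified_trace t : Prop :=
  is_trace t /\
  forall (P : Proj) (X : C) (f : Hom (X \ox P) (rddual D X \ox P)),
    t P (left_partial_trace f) = t (projl X P) ((piv_rddual X \om idm P) \c f).

(* [T] is a linear subspace of the space of all families, with a basis of
   cardinality [n]. *)
Definition has_dim (T : trace_family -> Prop) (n : nat) : Prop :=
  exists b : 'I_n -> trace_family,
    (forall t, T t <-> exists c : 'I_n -> k,
       forall P f, t P f = \sum_(i < n) c i * b i P f) /\
    (forall c : 'I_n -> k,
       (forall P f, \sum_(i < n) c i * b i P f = 0) -> forall i, c i = 0).
End Traces.

(* Main.v *)
(* A natural pairing Hom(P, 1) x Hom(1, P) -> k on projectives is the same as a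
   morphism 1 -> alpha, because Hom(P, alpha) = Hom(1, P)^* for P projective.
   If it is non-zero it is non-degenerate: 1 is simple, so a non-zero P -> 1 is
   epi and every Q -> 1 factors through it; dually, as P^* is again projective,
   every 1 -> Q factors through a given non-zero 1 -> P.  Hence C is unimodular
   iff a non-zero natural pairing B exists.  Two pairings B, B' are proportional:
   with c an eigenvalue of B^-1 B' on some Hom(P, 1), the pairing B' - c B is
   degenerate, hence zero.
   A right modified trace t yields the pairing (g, f) |-> t(f g), and t is
   recovered from it since every endomorphism of P is the partial trace of an
   endomorphism of P (x) P^* factoring through 1.  Conversely B yields the trace
   t_P(f) = B(ev~_P, (f (x) id) coev_P) on P (x) P^*, with ev~ the pivotal
   evaluation; then t_P(f g) = B(ev~_M (g (x) id), (f (x) id) coev_M), so t is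
   non-degenerate.  Left modified traces are right modified traces of the
   category with reversed tensor product. *)
From HB Require Import structures.
From Stdlib Require Import ProofIrrelevance Classical ClassicalEpsilon.
From mathcomp Require Import all_boot all_order all_algebra all_field.
Require Import Defs.

Set Implicit Arguments.
Unset Strict Implicit.
Unset Printing Implicit Defensive.

Import GRing.Theory.
Import VectorInternalTheory.
Local Open Scope ring_scope.

(** * Linear algebra *)

Section LinearAlgebra.
Variable k : fieldType.
Implicit Types U V W : vectType k.

Lemma linfun_linear V W (f : V -> W) : linear f -> linfun f =1 f.
Proof.
move=> lin v.
pose L := GRing.isLinear.Build k _ _ _ _ lin.
pose h : {linear V -> W} := HB.pack f L.
exact: (lfunE h v).
Qed.

Lemma lker0_of V W (f : 'Hom(V, W)) : (forall v, f v = 0 -> v = 0) -> lker f == 0%VS.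
Proof.
by move=> f0; apply/lker0P=> u v uv; apply/eqP; rewrite -subr_eq0; apply/eqP/f0;
  rewrite linearB /= uv subrr.
Qed.

Lemma dual_separates V (v : V) : v != 0 -> exists xi : dual V, xi v != 0.
Proof.
move=> v0; pose X := vbasis (fullv : {vspace V}).
have [i ci] : exists i, coord X i v != 0.
  apply/existsP; apply: contraR v0; rewrite negb_exists => /forallP c0.
  rewrite (coord_vbasis (memvf v)) big1 // => i _.
  by move: (c0 i); rewrite negbK => /eqP ->; rewrite scale0r.
exists (linfun (coord X i : V -> k^o)); by rewrite lfunE.
Qed.

(** Project to a complement along [U] and apply a functional that does not vanish on the image of
    [v]; that image is non-zero because [v] is outside [U]. *)
Lemma dual_separates_sub V (U : {vspace V}) v :
  v \notin U -> exists2 xi : dual V, (forall u, u \in U -> xi u = 0) & xi v != 0.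
Proof.
move=> vU; pose pr := daddv_pi (U^C) U.
have dUC : (U :&: U^C = 0)%VS by exact: capv_compl.
have dCU : (U^C :&: U = 0)%VS by rewrite capvC.
have dec w : pr w + daddv_pi U (U^C) w = w.
  by apply: daddv_pi_add => //; rewrite addvC addv_complf memvf.
have [|xi xi0] := @dual_separates V (pr v).
  by apply: contra vU => /eqP p0; rewrite -[v]dec p0 add0r memv_pi.
exists (xi \o pr)%VF; last by rewrite comp_lfunE.
move=> u uU; rewrite comp_lfunE; suff -> : pr u = 0 by rewrite linear0.
by apply/eqP; rewrite -(subrr u) -{2}(dec u) daddv_pi_id ?addrK.
Qed.

Lemma dim_dual V : \dim {:dual V} = \dim {:V}.
Proof. by rewrite !dimvf /dim /= muln1. Qed.

Lemma lker0_limgf_dim V W (f : 'Hom(V, W)) :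
  lker f == 0%VS -> (\dim {:W} <= \dim {:V})%N -> limg f = fullv.
Proof.
move=> kf le; apply/eqP; rewrite eqEdim subvf /=.
by rewrite limg_dim_eq // (eqP kf) capv0.
Qed.
End LinearAlgebra.

(** Algebraic closure gives a root of the characteristic polynomial, whose degree is positive
    because [v] forces the dimension to be positive. *)
Lemma eigenvector (k : closedFieldType) (V : vectType k) (f : 'End(V)) (v : V) :
  v != 0 -> exists c w, w != 0 /\ f w = c *: w.
Proof.
move=> v0; pose A := lin1_mx (v2r \o f \o r2v).
have fE w : f w = r2v (v2r w *m A) by rewrite mul_rV_lin1 /= !v2rK.
have n0 : (0 < dim V)%N.
  rewrite lt0n; apply: contra v0 => /eqP n0.
  rewrite -[v]v2rK; suff -> : v2r v = 0 by rewrite linear0.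
  by move: (v2r v); rewrite n0 => r; rewrite thinmx0.
have : size (char_poly A) != 1%N by rewrite size_char_poly; case: (dim V) n0.
case/closed_rootP => c; rewrite -eigenvalue_root_char => /eigenvalueP[r rA r0].
exists c, (r2v r); split; last by rewrite fE r2vK rA linearZ.
by apply: contra r0 => /eqP w0; rewrite -[r]r2vK w0 linear0.
Qed.

(** * Finite abelian categories *)

Section LinearCategory.
Variables (k : fieldType) (C : klincat k).
Implicit Types X Y Z : C.

Lemma hcomp0r X Y Z (g : Hom Y Z) : g \c (0 : Hom X Y) = 0.
Proof. by rewrite -postcompE linear0. Qed.
Lemma hcomp0l X Y Z (f : Hom X Y) : (0 : Hom Y Z) \c f = 0.
Proof. by rewrite -precompE linear0. Qed.
Lemma hcompZr X Y Z c (g : Hom Y Z) (f : Hom X Y) : g \c (c *: f) = c *: (g \c f).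
Proof. by rewrite -!postcompE linearZ. Qed.
Lemma hcomp_sumr X Y Z n (g : Hom Y Z) (f : 'I_n -> Hom X Y) :
  g \c (\sum_i f i) = \sum_i g \c f i.
Proof. by rewrite -postcompE linear_sum; apply: eq_bigr => i _; rewrite -postcompE. Qed.
Lemma hcomp_suml X Y Z n (g : 'I_n -> Hom Y Z) (f : Hom X Y) :
  (\sum_i g i) \c f = \sum_i g i \c f.
Proof. by rewrite -precompE linear_sum; apply: eq_bigr => i _; rewrite -precompE. Qed.

Lemma hom_from_zero X Y (f : Hom X Y) : is_zero X -> f = 0.
Proof. by move=> X0; rewrite -[f]hcompm1 X0 hcomp0r. Qed.
End LinearCategory.

(** * Modules over a finite-dimensional algebra *)

Section ModuleConstructions.
Variables (k : fieldType) (A : falgType k).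
Implicit Types V W : fdmod A.

Lemma fdact1E V (v : V) : fdact V 1 v = v.
Proof. by rewrite fdact1 id_lfunE. Qed.
Lemma fdactME V a b (v : V) : fdact V (a * b) v = fdact V a (fdact V b v).
Proof. by rewrite fdactM comp_lfunE. Qed.

Section Build.
Variables (V : vectType k) (act : A -> V -> V).
Hypotheses (act_lin_l : forall v, linear (fun a => act a v)).
Hypotheses (act_lin_r : forall a, linear (act a)).
Hypotheses (act1 : forall v, act 1 v = v).
Hypotheses (actM : forall a b v, act (a * b) v = act a (act b v)).

Definition act_lfun (a : A) : 'End(V) := linfun (act a).
Lemma act_lfunE a v : act_lfun a v = act a v.
Proof. exact: (linfun_linear (act_lin_r a)). Qed.
Lemma act_lfun_linear : linear act_lfun.
Proof.
move=> c a b; apply/lfunP => v.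
by rewrite add_lfunE scale_lfunE !act_lfunE act_lin_l.
Qed.
Definition act_linear : {linear A -> 'End(V)} :=
  HB.pack act_lfun (GRing.isLinear.Build k _ _ _ _ act_lfun_linear).
Lemma act_linear1 : act_linear 1 = \1%VF.
Proof. by apply/lfunP=> v; rewrite /= act_lfunE id_lfunE act1. Qed.
Lemma act_linearM a b : act_linear (a * b) = (act_linear a \o act_linear b)%VF.
Proof. by apply/lfunP=> v; rewrite comp_lfunE /= !act_lfunE actM. Qed.
Definition build_fdmod : fdmod A := FdMod act_linear1 act_linearM.
Lemma build_fdmodE a (v : V) : fdact build_fdmod a v = act a v.
Proof. exact: act_lfunE. Qed.
End Build.

Lemma modHom_of V W (f : 'Hom(V, W)) :
  (forall a v, f (fdact V a v) = fdact W a (f v)) ->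
  exists g : modHom V W, vsval g = f.
Proof. by move=> fA; exists (Subvs (introT (modhomP f) fA)). Qed.

Lemma modHomE V W (f : modHom V W) a v : vsval f (fdact V a v) = fdact W a (vsval f v).
Proof. exact: (modhomP _ (subvsP f)). Qed.

(** The regular left module with [g] the unit of [A]: free on one generator. *)
Lemma regular_fdmod : exists (M : fdmod A) (g : M),
  (forall V (x : V), exists f : modHom M V, vsval f g = x) /\
  (forall y : M, exists a, y = fdact M a g).
Proof.
have l1 (v : A) : linear (fun a => a * v) by move=> c a b; rewrite mulrDl scalerAl.
have l2 (a : A) : linear (fun v : A => a * v).
  by move=> c u v; rewrite mulrDr scalerAr.
pose M : fdmod A := build_fdmod l1 l2 (@mul1r A) (fun a b v => esym (mulrA a b v)).
exists M, (1 : A); split; last by move=> y; exists y; rewrite build_fdmodE mulr1.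
move=> V x.
have l3 : linear (fun a : A => fdact V a x).
  by move=> c a b; rewrite linearP add_lfunE scale_lfunE.
have [|f fE] := @modHom_of M V (linfun (fun a : A => fdact V a x)).
  by move=> a v; rewrite !(linfun_linear l3) build_fdmodE fdactME.
by exists f; rewrite fE (linfun_linear l3) fdact1E.
Qed.

(* The dual of the regular right module; [q] is the evaluation pairing. *)
Lemma coregular_fdmod : exists (M : fdmod A) (q : M -> A -> k),
  [/\ forall c u v a, q (c *: u + v) a = c * q u a + q v a,
      forall u v, (forall a, q u a = q v a) -> u = v,
      forall u a b, q (fdact M a u) b = q u (b * a) &
      forall V (xi : dual V), exists f : modHom V M,
        forall v a, q (vsval f v) a = xi (fdact V a v)].
Proof.
pose D := dual A.
have lm (a : A) (u : D) : linear (fun b => u (b * a) : k^o).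
  by move=> c x y; rewrite mulrDl -scalerAl linearP.
pose act (a : A) (u : D) : D := linfun (fun b => u (b * a) : k^o).
have aE a u b : act a u b = u (b * a) by exact: (linfun_linear (lm a u)).
have l1 (v : D) : linear (fun a => act a v).
  move=> c a b; apply/lfunP=> x; rewrite add_lfunE scale_lfunE !aE.
  by rewrite mulrDr -scalerAr linearP.
have l2 (a : A) : linear (act a).
  move=> c u v; apply/lfunP=> x.
  by rewrite [RHS]add_lfunE scale_lfunE !aE add_lfunE scale_lfunE.
have a1 v : act 1 v = v by apply/lfunP=> x; rewrite aE mulr1.
have aM a b v : act (a * b) v = act a (act b v).
  by apply/lfunP=> x; rewrite !aE mulrA.
pose M : fdmod A := build_fdmod l1 l2 a1 aM.
exists M, (fun u a => (u : D) a); split.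
- by move=> c u v a; rewrite add_lfunE scale_lfunE.
- by move=> u v uv; apply/lfunP.
- by move=> u a b; rewrite build_fdmodE aE.
move=> V xi.
have l3 v : linear (fun a => xi (fdact V a v) : k^o).
  by move=> c x y; rewrite linearP add_lfunE scale_lfunE linearP.
pose h v : D := linfun (fun a => xi (fdact V a v) : k^o).
have hE v a : h v a = xi (fdact V a v) by exact: (linfun_linear (l3 v)).
have l4 : linear h.
  move=> c x y; apply/lfunP=> a; rewrite [RHS]add_lfunE scale_lfunE !hE.
  by rewrite !linearP.
have [|f fE] := @modHom_of V M (linfun h).
  move=> a v; rewrite !(linfun_linear l4) build_fdmodE.
  by apply/lfunP=> b; rewrite aE !hE fdactME.
by exists f => v a; rewrite fE (linfun_linear l4) hE.
Qed.

(** Finite powers serve twice: copowers are powers of an object, and every object is covered by a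
    power of a generator. *)
Lemma power_fdmod V n : exists (M : fdmod A) (i : 'I_n -> modHom V M)
    (p : 'I_n -> modHom M V),
  (forall j j', modComp (p j) (i j') = if j == j' then modId V else 0) /\
  \sum_j modComp (i j) (p j) = modId M.
Proof.
pose T := {ffun 'I_n -> V}.
pose act (a : A) (u : T) : T := [ffun j => fdact V a (u j)].
have l1 (v : T) : linear (fun a => act a v).
  by move=> c a b; apply/ffunP=> j; rewrite !ffunE linearP add_lfunE scale_lfunE.
have l2 (a : A) : linear (act a).
  by move=> c u v; apply/ffunP=> j; rewrite !ffunE linearP.
have a1 v : act 1 v = v by apply/ffunP=> j; rewrite ffunE fdact1E.
have aM a b v : act (a * b) v = act a (act b v).
  by apply/ffunP=> j; rewrite !ffunE fdactME.
pose M : fdmod A := build_fdmod l1 l2 a1 aM.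
pose inj j (v : V) : T := [ffun j' => if j == j' then v else 0].
have li j : linear (inj j).
  move=> c u v; apply/ffunP=> j'; rewrite !ffunE.
  by case: eqP; rewrite ?scaler0 ?addr0.
have lp (j : 'I_n) : linear (fun u : T => u j) by move=> c u v; rewrite !ffunE.
have hi j : {g : modHom V M | vsval g = linfun (inj j)}.
  apply: constructive_indefinite_description; apply: modHom_of => a v.
  rewrite !(linfun_linear (li j)) build_fdmodE; apply/ffunP=> j'; rewrite !ffunE.
  by case: eqP => // _; rewrite linear0.
have hp j : {g : modHom M V | vsval g = linfun (fun u : T => u j)}.
  apply: constructive_indefinite_description; apply: modHom_of => a v.
  by rewrite !(linfun_linear (lp j)) build_fdmodE ffunE.
exists M, (fun j => sval (hi j)), (fun j => sval (hp j)); split.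
  move=> j j'; apply: val_inj; apply/lfunP=> v /=.
  rewrite comp_lfunE (svalP (hi j')) (svalP (hp j)) (linfun_linear (li j')).
  rewrite (linfun_linear (lp j)) ffunE eq_sym.
  by case: eqP; rewrite /= ?id_lfunE // zero_lfunE.
apply: val_inj; rewrite raddf_sum; apply/lfunP=> v /=.
rewrite sum_lfunE id_lfunE; apply/ffunP=> j.
rewrite sum_ffunE (bigD1 j) //= big1 ?addr0 => [|j' ne].
  rewrite comp_lfunE (svalP (hi j)) (svalP (hp j)) (linfun_linear (li j)).
  by rewrite (linfun_linear (lp j)) ffunE eqxx.
rewrite comp_lfunE (svalP (hi j')) (linfun_linear (li j')) ffunE.
by rewrite (negPf ne).
Qed.

Lemma image_fdmod V W (f : modHom V W) : exists (S : fdmod A) (e : modHom V S)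
    (i : modHom S W),
  [/\ f = modComp i e, injective (vsval i) & forall y, exists x, vsval e x = y].
Proof.
pose U := limg (vsval f).
have aU a (u : W) : u \in U -> fdact W a u \in U.
  by case/memv_imgP => v _ ->; rewrite -modHomE memv_img ?memvf.
pose act (a : A) (u : subvs_of U) : subvs_of U := Subvs (aU a _ (subvsP u)).
have l1 (v : subvs_of U) : linear (fun a => act a v).
  by move=> c a b; apply: val_inj; rewrite /= !linearP add_lfunE scale_lfunE.
have l2 (a : A) : linear (act a).
  by move=> c u v; apply: val_inj; rewrite /= !linearP.
have a1 v : act 1 v = v by apply: val_inj; rewrite /= fdact1E.
have aM a b v : act (a * b) v = act a (act b v).
  by apply: val_inj; rewrite /= fdactME.
pose M : fdmod A := build_fdmod l1 l2 a1 aM.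
have fU v : vsval f v \in U by rewrite memv_img ?memvf.
pose e (v : V) : subvs_of U := Subvs (fU v).
have le : linear e by move=> c u v; apply: val_inj; rewrite /= !linearP.
have li : linear (@vsval _ _ U) by exact: linearP.
have [|e' eE] := @modHom_of V M (linfun e).
  move=> a v; rewrite !(linfun_linear le) build_fdmodE; apply: val_inj => /=.
  by rewrite modHomE.
have [|i' iE] := @modHom_of M W (linfun (@vsval _ _ U)).
  by move=> a v; rewrite !(linfun_linear li) build_fdmodE.
exists M, e', i'; split.
- apply: val_inj; apply/lfunP=> v /=.
  by rewrite comp_lfunE eE iE (linfun_linear le) (linfun_linear li).
- by move=> u v; rewrite iE !(linfun_linear li) => /val_inj.
move=> y; have /memv_imgP[x _ xE] := subvsP (y : subvs_of U).
by exists x; rewrite eE (linfun_linear le); apply: val_inj; rewrite /= xE.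
Qed.
End ModuleConstructions.

(** * Transport of module constructions along an equivalence *)

Section Equivalence.
Variables (k : fieldType) (C D : klincat k).

Lemma equivalent_fully_faithful : equivalent C D -> exists F : functor C D,
  [/\ forall X Y (f g : Hom X Y), fmap F f = fmap F g -> f = g,
      forall X Y (h : Hom (F X) (F Y)), exists f, fmap F f = h &
      forall M : D, exists X (u : Hom (F X) M) (v : Hom M (F X)),
        u \c v = idm M /\ v \c u = idm (F X)].
Proof.
case=> F [G [eta [eps [eta_nat eta_iso eps_nat eps_iso]]]]; exists F.
have Ff X Y (f g : Hom X Y) : fmap F f = fmap F g -> f = g.
  move=> fg; have [i [_ iK]] := eta_iso Y; have [j [jK _]] := eta_iso Y.
  by rewrite -(hcomp1m f) -(hcomp1m g) -jK -!hcompA !eta_nat fg.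
have Gf X Y (f g : Hom X Y) : fmap G f = fmap G g -> f = g.
  move=> fg; have [j [_ jK]] := eps_iso X.
  by rewrite -(hcompm1 f) -(hcompm1 g) -jK !hcompA !eps_nat fg.
split=> // [X Y h | M]; last first.
  have [v [vK Kv]] := eps_iso M; by exists (G M), (eps M), v.
have [j [jK Kj]] := eta_iso Y; have [j' [jK' Kj']] := eta_iso X.
(* The preimage of [h] is [G h] conjugated by [eta]. Naturality of [eta] shows that [G] sends its
   image under [F] to [G h], and [G] is faithful. *)
exists (j \c fmap G h \c eta X); apply: Gf.
have : eta Y \c (j \c fmap G h \c eta X) = fmap G h \c eta X.
  by rewrite !hcompA Kj hcomp1m.
rewrite eta_nat => /(congr1 (fun u => u \c j')).
by rewrite -!hcompA Kj' !hcompm1.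
Qed.
End Equivalence.

Section FiniteAbelian.
Variables (k : fieldType) (C : klincat k).
Hypothesis finC : finite_abelian C.

Section WithFunctor.
Variables (A : falgType k) (F : functor C (fdmod_cat A)).
Hypothesis F_inj : forall X Y (f g : Hom X Y), fmap F f = fmap F g -> f = g.
Hypothesis F_full : forall X Y (h : Hom (F X) (F Y)), exists f, fmap F f = h.
Hypothesis F_ess : forall M : fdmod_cat A, exists X (u : Hom (F X) M) (v : Hom M (F X)),
  u \c v = idm M /\ v \c u = idm (F X).
Implicit Types X Y Z : C.

(** [Fo X] is the module behind [X] and [ap f] the linear map behind [f], so that objects of [C] can
    be handled by elements. *)
Let Fo X : fdmod A := F X.
Let ap X Y (f : Hom X Y) : 'Hom(Fo X, Fo Y) := vsval (fmap F f : modHom (Fo X) (Fo Y)).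

Let apM X Y Z (g : Hom Y Z) (f : Hom X Y) x : ap (g \c f) x = ap g (ap f x).
Proof. by rewrite /ap fmapM /= comp_lfunE. Qed.
Let ap1 X x : ap (idm X) x = x.
Proof. by rewrite /ap fmap1 /= id_lfunE. Qed.
Let apA X Y (f : Hom X Y) a x : ap f (fdact (Fo X) a x) = fdact (Fo Y) a (ap f x).
Proof. exact: modHomE. Qed.
Let ap_inj X Y (f g : Hom X Y) : (forall x, ap f x = ap g x) -> f = g.
Proof. by move=> fg; apply: F_inj; apply: val_inj; apply/lfunP. Qed.
Let apP X Y c (f g : Hom X Y) x : ap (c *: f + g) x = c *: ap f x + ap g x.
Proof. by rewrite /ap fmap_linear linearP add_lfunE scale_lfunE. Qed.
Let ap0 X Y x : ap (0 : Hom X Y) x = 0.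
Proof.
by have := apP (-1) (0 : Hom X Y) 0 x; rewrite scaler0 addr0 => ->; rewrite scaleN1r addNr.
Qed.
Let ap_full X Y (h : modHom (Fo X) (Fo Y)) : exists f, forall x, ap f x = vsval h x.
Proof. by have [f fE] := F_full (h : Hom (F X) (F Y)); exists f => x; rewrite /ap fE. Qed.

Let ess (M : fdmod A) : exists X (u : modHom (Fo X) M) (v : modHom M (Fo X)),
  (forall x, vsval u (vsval v x) = x) /\ (forall x, vsval v (vsval u x) = x).
Proof.
have [X [u [v [uv vu]]]] := F_ess M; exists X, u, v; split=> x.
  by have := congr1 (fun f : modHom M M => vsval f x) uv; rewrite /= comp_lfunE id_lfunE.
by have := congr1 (fun f : modHom (Fo X) (Fo X) => vsval f x) vu;
  rewrite /= comp_lfunE id_lfunE.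
Qed.

Let surj_epi X Y (e : Hom X Y) : (forall y, exists x, ap e x = y) -> is_epi e.
Proof.
move=> eS Z u v uv; apply: ap_inj => y; have [x <-] := eS y.
by rewrite -!apM uv.
Qed.

(** If [y] were outside the image of [e], a functional that kills this submodule but not [y] would
    correspond to a map into the coregular module that kills [e] but not [y]. *)
Let epi_surj X Y (e : Hom X Y) : is_epi e -> forall y, exists x, ap e x = y.
Proof.
move=> e_epi y; case yE: (y \in limg (ap e)).
  by have /memv_imgP[x _ ->] := yE; exists x.
have [xi xi0 xiy] := dual_separates_sub (negbT yE).
have [M [q [_ q_inj _ /(_ _ xi)[f fE]]]] := coregular_fdmod A.
have [X' [u [v [uv _]]]] := ess M.
have [h hE] := ap_full (modComp v f).
have h0 : h = 0.
  apply: (e_epi); rewrite hcomp0l; apply: ap_inj => x.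
  rewrite apM hE ap0 /= comp_lfunE; suff -> : vsval f (ap e x) = 0 by rewrite linear0.
  apply: q_inj => a; rewrite fE -apA xi0 ?memv_img ?memvf //.
  by rewrite -(linear0 (vsval f)) fE !linear0.
case/eqP: xiy; rewrite -(fdact1E y) -fE -[vsval f y]uv.
have := hE y; rewrite h0 ap0 /= comp_lfunE => <-.
by rewrite !linear0 -(linear0 (vsval f)) fE !linear0.
Qed.

Let inj_mono X Y (i : Hom X Y) : injective (ap i) -> is_mono i.
Proof. by move=> ii W u v uv; apply: ap_inj => x; apply: ii; rewrite -!apM uv. Qed.

Lemma F_image X Y (f : Hom X Y) : exists S (e : Hom X S) (i : Hom S Y),
  [/\ f = i \c e, is_mono i & is_epi e].
Proof.
have [S [e [i [fE ii eS]]]] := image_fdmod (fmap F f : modHom (Fo X) (Fo Y)).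
have [S' [u [v [uv vu]]]] := ess S.
have [e' e'E] := ap_full (modComp v e); have [i' i'E] := ap_full (modComp i u).
exists S', e', i'; split.
- apply: ap_inj => x; rewrite apM e'E i'E /= !comp_lfunE uv /ap fE /=.
  by rewrite comp_lfunE.
- apply: inj_mono => x y; rewrite !i'E /= !comp_lfunE => /ii.
  by move/(congr1 (vsval v)); rewrite !vu.
apply: surj_epi => y; have [x xE] := eS (vsval u y); exists x.
by rewrite e'E /= comp_lfunE xE vu.
Qed.

Lemma F_biproduct X n : exists (T : C) (i : 'I_n -> Hom X T) (p : 'I_n -> Hom T X),
  (forall j j', p j \c i j' = if j == j' then idm X else 0) /\
  \sum_j i j \c p j = idm T.
Proof.
have [M [i [p [pi ip]]]] := power_fdmod (Fo X) n.
have [T [u [v [uv vu]]]] := ess M.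
have hi j : {f : Hom X T | forall x, ap f x = vsval (modComp v (i j)) x}.
  by apply: constructive_indefinite_description; apply: ap_full.
have hp j : {f : Hom T X | forall x, ap f x = vsval (modComp (p j) u) x}.
  by apply: constructive_indefinite_description; apply: ap_full.
exists T, (fun j => sval (hi j)), (fun j => sval (hp j)); split.
  move=> j j'; apply: ap_inj => x; rewrite apM (svalP (hi j')) (svalP (hp j)) /=.
  rewrite !comp_lfunE uv; have := congr1 (fun f : modHom (Fo X) (Fo X) => vsval f x) (pi j j').
  by rewrite /= comp_lfunE => ->; case: eqP; rewrite /= ?ap0 ?zero_lfunE ?id_lfunE ?ap1.
apply: ap_inj => x; rewrite ap1 -[RHS]vu.
have -> : vsval u x = \sum_j vsval (i j) (vsval (p j) (vsval u x)).
  have := congr1 (fun f : modHom M M => vsval f (vsval u x)) ip.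
  rewrite /= raddf_sum id_lfunE sum_lfunE => {1}<-.
  by apply: eq_bigr => j _; rewrite /= comp_lfunE.
rewrite linear_sum.
have ap_lin : linear (fun f : Hom T T => ap f x) by move=> c f g; exact: apP.
rewrite -(linfun_linear ap_lin) linear_sum; apply: eq_bigr => j _.
transitivity (ap (sval (hi j) \c sval (hp j)) x); first exact: (linfun_linear ap_lin).
by rewrite apM (svalP (hi j)) (svalP (hp j)) /= !comp_lfunE.
Qed.

(* The last clause represents X |-> Hom(G, X)^*, up to the bijectivity of [nu]. *)
Lemma F_generator : exists G : C,
  [/\ projective G,
      forall X Y (e : Hom X Y), (forall p : Hom G Y, exists q, p = e \c q) -> is_epi e,
      forall X Y N (e : Hom X Y) (h : Hom X N), is_epi e ->
        (forall a : Hom G X, e \c a = 0 -> h \c a = 0) -> exists h', h' \c e = h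
    & exists N (nu : forall X, dual (Hom G X) -> Hom X N),
        [/\ forall X, linear (@nu X), forall X xi, nu X xi = 0 -> xi = 0 &
          forall X Y (f : Hom X Y) (xi : dual (Hom G Y)),
            nu X (xi \o postcomp f)%VF = nu Y xi \c f]].
Proof.
have [R [r [Rfree Rgen]]] := regular_fdmod A.
have [G [u [v [uv vu]]]] := ess R; pose g : Fo G := vsval v r.
have Gfree X (x : Fo X) : exists f : Hom G X, ap f g = x.
  have [h hx] := Rfree _ x; have [f fE] := ap_full (modComp h u).
  by exists f; rewrite fE /= comp_lfunE uv.
have Ggen (y : Fo G) : exists a, y = fdact (Fo G) a g.
  have [a aE] := Rgen (vsval u y); exists a.
  by rewrite -[y]vu aE modHomE.
have G_inj X (f f' : Hom G X) : ap f g = ap f' g -> f = f'.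
  by move=> ff; apply: ap_inj => y; have [a ->] := Ggen y; rewrite !apA ff.
exists G; split.
- move=> X Y e f /epi_surj eS; have [x xE] := eS (ap f g).
  have [h hE] := Gfree _ x; exists h; apply: G_inj.
  by rewrite apM hE.
- move=> X Y e eP; apply: surj_epi => y; have [p pE] := Gfree _ y.
  by have [q qE] := eP p; exists (ap q g); rewrite -apM -qE.
- move=> X Y N e h /epi_surj eS ker.
  have kerF x : ap e x = 0 -> ap h x = 0.
    have [a aE] := Gfree _ x; move=> ex; rewrite -aE -apM ker ?ap0 //.
    by apply: G_inj; rewrite apM aE ex ap0.
  have sE y : ap e ((ap e)^-1%VF y) = y.
    by rewrite limg_lfunVK //; have [x <-] := eS y; rewrite memv_img ?memvf.
  have kerE x x' : ap e x = ap e x' -> ap h x = ap h x'.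
    move=> xx; apply/eqP; rewrite -subr_eq0 -linearB; apply/eqP/kerF.
    by rewrite linearB /= xx subrr.
  (* The inverse of [ap e] is only a linear section. By [kerE] its composite with [ap h] does not
     depend on the choice of preimages, hence is [A]-linear. *)
  have [|h' h'E] := @modHom_of _ _ (Fo Y) (Fo N) (ap h \o (ap e)^-1)%VF.
    move=> a y; rewrite !comp_lfunE -apA; apply: kerE.
    by rewrite apA !sE.
  have [f fE] := ap_full h'; exists f; apply: ap_inj => x.
  by rewrite apM fE h'E comp_lfunE; apply: kerE; rewrite sE.
have [M [q [q_lin q_inj qA q_univ]]] := coregular_fdmod A.
have [N [u' [v' [uv' vu']]]] := ess M.
have el_lin X : linear (fun f : Hom G X => ap f g) by move=> c f f'; exact: apP.
(* Evaluation at the generator identifies [Hom G X] with the module behind [X]; a functional on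
   [Hom G X] thus becomes one on that module, and then a map to the coregular module [N]. *)
pose el X := linfun (fun f : Hom G X => ap f g).
have elE X (f : Hom G X) : el X f = ap f g by exact: (linfun_linear (@el_lin X)).
have elK X x : el X ((el X)^-1%VF x) = x.
  rewrite limg_lfunVK //; have [f <-] := Gfree _ x.
  by rewrite -elE memv_img ?memvf.
have Kel X f : (el X)^-1%VF (el X f) = f.
  by apply: G_inj; rewrite -!elE elK.
have nuP X (xi : dual (Hom G X)) : {f : Hom X N | forall x a,
    q (vsval u' (ap f x)) a = xi ((el X)^-1%VF (fdact (Fo X) a x))}.
  apply: constructive_indefinite_description.
  have [h hE] := q_univ (Fo X) (xi \o (el X)^-1)%VF.
  have [f fE] := ap_full (modComp v' h); exists f => x a.
  by rewrite fE /= comp_lfunE uv' hE comp_lfunE.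
have nu_inj X (f f' : Hom X N) :
    (forall x a, q (vsval u' (ap f x)) a = q (vsval u' (ap f' x)) a) -> f = f'.
  move=> ff; apply: ap_inj => x; rewrite -[LHS]vu' -[RHS]vu'.
  by congr (vsval v' _); apply: q_inj.
exists N, (fun X xi => sval (nuP X xi)); split.
- move=> X c xi xi'; apply: nu_inj => x a.
  rewrite (svalP (nuP X _)) apP linearP q_lin !(svalP (nuP X _)).
  by rewrite add_lfunE scale_lfunE.
- move=> X xi xi0; apply/lfunP=> f.
  have := svalP (nuP X xi) (ap f g) 1.
  rewrite xi0 ap0 fdact1E -elE Kel zero_lfunE => <-.
  by rewrite linear0; have := q_lin (-1) 0 0 1; rewrite scaler0 addr0 mulN1r addNr.
move=> X Y f xi; apply: nu_inj => x a.
rewrite (svalP (nuP X _)) apM (svalP (nuP Y _)) comp_lfunE postcompE -apA.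
congr (xi _); apply: G_inj; rewrite apM -!elE !elK.
by [].
Qed.
End WithFunctor.

Lemma finite_abelian_image X Y (f : Hom X Y) : exists (S : C) (e : Hom X S) (i : Hom S Y),
  [/\ f = i \c e, is_mono i & is_epi e].
Proof.
have [A /equivalent_fully_faithful[F [F1 F2 F3]]] := finC.
exact: (F_image F1 F2 F3).
Qed.

Lemma finite_abelian_biproduct (X : C) n :
  exists (T : C) (i : 'I_n -> Hom X T) (p : 'I_n -> Hom T X),
  (forall j j', p j \c i j' = if j == j' then idm X else 0) /\
  \sum_j i j \c p j = idm T.
Proof.
have [A /equivalent_fully_faithful[F [F1 F2 F3]]] := finC.
exact: (F_biproduct F1 F2 F3).
Qed.

Lemma finite_abelian_generator : exists G : C,
  [/\ projective G,
      forall X Y (e : Hom X Y), (forall p : Hom G Y, exists q, p = e \c q) -> is_epi e,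
      forall X Y N (e : Hom X Y) (h : Hom X N), is_epi e ->
        (forall a : Hom G X, e \c a = 0 -> h \c a = 0) -> exists h', h' \c e = h
    & exists N (nu : forall X, dual (Hom G X) -> Hom X N),
        [/\ forall X, linear (@nu X), forall X xi, nu X xi = 0 -> xi = 0 &
          forall X Y (f : Hom X Y) (xi : dual (Hom G Y)),
            nu X (xi \o postcomp f)%VF = nu Y xi \c f]].
Proof.
have [A /equivalent_fully_faithful[F [F1 F2 F3]]] := finC.
exact: (F_generator F1 F2 F3).
Qed.

(** The copower is a power of [M] whose summands are labelled by a basis of [V]. *)
Lemma finite_abelian_copower (V : vectType k) (M : C) : inhabited (copower V M).
Proof.
have [T [i [p [pi ip]]]] := finite_abelian_biproduct M (\dim (fullv : {vspace V})).
pose e := vbasis (fullv : {vspace V}).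
have ce v : v = \sum_j coord e j v *: e`_j by exact: (coord_vbasis (memvf v)).
have ee (j j' : 'I__) : coord e j e`_j' = (j == j')%:R.
  by rewrite coord_free 1?eq_sym //; exact: basis_free (vbasisP _).
pose hom N (h : Hom T N) : V -> Hom M N := fun v => \sum_j coord e j v *: (h \c i j).
have hom_lin N (h : Hom T N) : linear (hom N h).
  move=> c u v; rewrite /hom scaler_sumr -big_split; apply: eq_bigr => j _.
  by rewrite linearP /= scalerDl scalerA.
have homE N h v : linfun (hom N h) v = hom N h v by exact: (linfun_linear (hom_lin N h)).
pose inv N (phi : 'Hom(V, Hom M N)) : Hom T N :=
  \sum_(j < \dim (fullv : {vspace V})) phi e`_j \c p j.
have homK N : cancel (fun h => linfun (hom N h)) (inv N).
  move=> h; rewrite /inv -[RHS]hcompm1 -ip hcomp_sumr; apply: eq_bigr => j _.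
  rewrite homE /hom (bigD1 j) //= big1 => [|j' ne]; rewrite ?addr0 ee.
    by rewrite eqxx scale1r hcompA.
  by rewrite (negPf ne) scale0r.
have invK N : cancel (inv N) (fun h => linfun (hom N h)).
  move=> phi; apply/lfunP=> v; rewrite homE [in RHS](ce v) linear_sum.
  apply: eq_bigr => j _; rewrite linearZ /= hcomp_suml (bigD1 j) //= big1 => [|j' ne].
    by rewrite addr0 -hcompA pi eqxx hcompm1.
  by rewrite -hcompA pi (negPf ne) hcomp0r.
have nat N N' (g : Hom N N') (h : Hom T N) :
    linfun (hom N' (g \c h)) = (postcomp g \o linfun (hom N h))%VF.
  apply/lfunP=> v; rewrite comp_lfunE postcompE !homE hcomp_sumr.
  by apply: eq_bigr => j _; rewrite hcompZr hcompA.
exact: (inhabits (Copower homK invK nat)).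
Qed.
End FiniteAbelian.

(** * Natural pairings and the coend *)

Section Pairings.
Variables (k : closedFieldType) (C : klincat k) (I : C).
Hypotheses (finC : finite_abelian C) (simpleI : is_simple I).
Implicit Types X Y P Q : C.

(** The power of [G] is indexed by a basis of [Hom G X], and [e] has the basis vectors as
    components, so every map from [G] to [X] factors through [e]. *)
Lemma generator_cover G X :
  (forall Y Z (e : Hom Y Z), (forall p : Hom G Z, exists q, p = e \c q) -> is_epi e) ->
  exists n (T : C) (i : 'I_n -> Hom G T) (p : 'I_n -> Hom T G) (e : Hom T X),
    [/\ forall j j', p j \c i j' = if j == j' then idm G else 0,
        \sum_j i j \c p j = idm T & is_epi e].
Proof.
move=> G_gen; pose V := Hom G X; pose n := \dim (fullv : {vspace V}).
have [T [i [p [pi ip]]]] := finite_abelian_biproduct finC G n.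
pose e := vbasis (fullv : {vspace V}).
exists n, T, i, p, (\sum_(j < n) (e`_j : Hom G X) \c p j); split=> //.
apply: G_gen => q; exists (\sum_(j < n) coord e j q *: i j).
rewrite [LHS](coord_vbasis (memvf q)) hcomp_sumr; apply: eq_bigr => j _.
rewrite hcompZr hcomp_suml (bigD1 j) //= big1 ?addr0 => [|j' ne].
  by rewrite -hcompA pi eqxx hcompm1.
by rewrite -hcompA pi (negPf ne) hcomp0r.
Qed.

Lemma enough_projectives X : exists P (e : Hom P X), projective P /\ is_epi e.
Proof.
have [G [G_proj G_gen _ _]] := finite_abelian_generator finC.
have [n [T [i [p [e [_ ip e_epi]]]]]] := generator_cover X G_gen.
exists T, e; split=> // Y Z q f q_epi.
have lift j : {g | q \c g = f \c i j}.
  by apply: constructive_indefinite_description; apply: G_proj.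
exists (\sum_j sval (lift j) \c p j); rewrite hcomp_sumr -[RHS]hcompm1 -ip hcomp_sumr.
by apply: eq_bigr => j _; rewrite hcompA (svalP (lift j)) hcompA.
Qed.

(* A morphism out of the source of an epimorphism descends as soon as it kills
   the morphisms from projectives killed by the epimorphism. *)
Lemma epi_descent X Y N (e : Hom X Y) (h : Hom X N) : is_epi e ->
  (forall Q (a : Hom Q X), projective Q -> e \c a = 0 -> h \c a = 0) ->
  exists h', h' \c e = h.
Proof.
have [G [G_proj _ descent _]] := finite_abelian_generator finC.
by move=> e_epi ker; apply: descent => // a; apply: ker.
Qed.

Lemma nonzero_to_simple_epi X (f : Hom X I) : f != 0 -> is_epi f.
Proof.
have [S [e [i [-> i_mono e_epi]]]] := finite_abelian_image finC f.
case: simpleI => _ /(_ S i i_mono) [S0 | [j [ji ij]]] f0.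
  by case/eqP: f0; rewrite [i](hom_from_zero _ S0) hcomp0l.
move=> Z u v; rewrite !hcompA => /e_epi uv.
by rewrite -[u]hcompm1 -[v]hcompm1 -ij !hcompA uv.
Qed.

(** Curried, so that non-degeneracy becomes invertibility of a linear map. *)
Definition pairing := forall P : C, projective P -> 'Hom(Hom P I, dual (Hom I P)).
Implicit Type B : pairing.

Definition pairing_val B P (hP : projective P) (g : Hom P I) (f : Hom I P) : k :=
  (B P hP g : dual (Hom I P)) f.

Definition natural_pairing B :=
  forall P Q (hP : projective P) (hQ : projective Q) (a : Hom P Q) g f,
    pairing_val B hP (g \c a) f = pairing_val B hQ g (a \c f).
Definition nonzero_pairing B :=
  exists P (hP : projective P) g f, pairing_val B hP g f != 0.

(* In a rigid category this follows from [nonzero_to_simple_epi] by duality. *)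
Hypothesis extension : forall P Q (f : Hom I P) (f' : Hom I Q),
  projective Q -> f != 0 -> exists a : Hom P Q, f' = a \c f.

Section Nondegenerate.
Variable B : pairing.
Hypotheses (B_nat : natural_pairing B) (B_neq0 : nonzero_pairing B).

Lemma pairing_nondegl P (hP : projective P) g : (forall f, pairing_val B hP g f = 0) -> g = 0.
Proof.
move=> g0; apply/eqP; apply/negPn/negP => gN0.
have [Q [hQ [h [f hf]]]] := B_neq0.
have [a aE] := hQ _ _ _ h (nonzero_to_simple_epi gN0).
by case/eqP: hf; rewrite -aE (@B_nat _ _ hQ hP) g0.
Qed.

Lemma pairing_nondegr P (hP : projective P) f : (forall g, pairing_val B hP g f = 0) -> f = 0.
Proof.
move=> f0; apply/eqP; apply/negPn/negP => fN0.
have [Q [hQ [g [f' gf]]]] := B_neq0.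
have [a aE] := extension f' hQ fN0.
by case/eqP: gf; rewrite aE -(@B_nat _ _ hP hQ) f0.
Qed.

Lemma pairing_lker0 P (hP : projective P) : lker (@B P hP) == 0%VS.
Proof.
apply: lker0_of => g g0; apply: (@pairing_nondegl P hP) => f.
by rewrite /pairing_val g0 zero_lfunE.
Qed.

(** Non-degeneracy in the second argument embeds [Hom I P] into the dual of [Hom P I]; this bounds
    the dimension of the target of the injective map [B], which is therefore onto. *)
Lemma pairing_limg P (hP : projective P) : limg (@B P hP) = fullv.
Proof.
apply: lker0_limgf_dim (pairing_lker0 hP) _.
pose T f : dual (Hom P I) := linfun (fun g => pairing_val B hP g f : k^o).
have TE f g : T f g = pairing_val B hP g f.
  apply: (linfun_linear (f := fun g => pairing_val B hP g f : k^o)) => c u v.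
  by rewrite /pairing_val linearP add_lfunE scale_lfunE.
have T_lin : linear T.
  by move=> c u v; apply/lfunP=> g; rewrite add_lfunE scale_lfunE !TE /pairing_val linearP.
have T0 : lker (linfun T) == 0%VS.
  apply: lker0_of => f; rewrite (linfun_linear T_lin) => f0.
  by apply: (@pairing_nondegr P hP) => g; rewrite -TE f0 zero_lfunE.
rewrite dim_dual -[X in (_ <= X)%N](dim_dual (Hom P I)).
have /eqP T0' := T0; rewrite -(@limg_dim_eq _ _ _ (linfun T)) ?dimvS ?subvf //.
by rewrite T0' capv0.
Qed.

Definition pairing_inv P (hP : projective P) : 'Hom(dual (Hom I P), Hom P I) :=
  (@B P hP)^-1%VF.

Lemma pairing_invK P (hP : projective P) xi : @B P hP (pairing_inv hP xi) = xi.
Proof. by rewrite /pairing_inv limg_lfunVK // pairing_limg memvf. Qed.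

Lemma pairing_Kinv P (hP : projective P) g : pairing_inv hP (@B P hP g) = g.
Proof. exact: lker0_lfunK (pairing_lker0 hP) g. Qed.

(** In other words, [I] represents the functor sending [P] to [dual (Hom I P)] on projectives. *)
Lemma pairing_inv_nat P Q (hP : projective P) (hQ : projective Q) (a : Hom P Q)
    (xi : dual (Hom I Q)) :
  pairing_inv hP (xi \o postcomp a)%VF = pairing_inv hQ xi \c a.
Proof.
apply: (can_inj (@pairing_Kinv P hP)); rewrite pairing_invK.
apply/lfunP=> f.
have := @B_nat _ _ hP hQ a (pairing_inv hQ xi) f; rewrite /pairing_val => ->.
by rewrite pairing_invK comp_lfunE postcompE.
Qed.

End Nondegenerate.

Lemma pairing_unique B B' : natural_pairing B -> nonzero_pairing B ->
  natural_pairing B' ->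
  exists c : k, forall P (hP : projective P) g f,
    pairing_val B' hP g f = c * pairing_val B hP g f.
Proof.
move=> B_nat B_neq0 B'_nat; have [P [hP [g [f gf]]]] := B_neq0.
have g0 : g != 0 by apply: contra gf => /eqP ->; rewrite /pairing_val linear0 zero_lfunE.
have [c [w [w0 wE]]] := eigenvector (pairing_inv B hP \o B' P hP)%VF g0.
have {}wE : B' P hP w = c *: B P hP w.
  by move/(congr1 (B P hP)): wE; rewrite comp_lfunE linearZ (pairing_invK B_nat B_neq0).
exists c => Q hQ h u; apply/eqP; rewrite -subr_eq0; apply/negPn/negP => neq0.
pose B'' : pairing := fun P hP => B' P hP - c *: B P hP.
have B''E P' (hP' : projective P') g' f' :
    pairing_val B'' hP' g' f' = pairing_val B' hP' g' f' - c * pairing_val B hP' g' f'.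
  by rewrite /pairing_val /B'' !(add_lfunE, opp_lfunE, scale_lfunE).
case/eqP: w0; apply: (@pairing_nondegl B'' _ _ P hP).
- by move=> P' Q' hP' hQ' a g' f'; rewrite !B''E (B'_nat _ _ _ hQ') (B_nat _ _ _ hQ').
- by exists Q, hQ, h, u; rewrite B''E.
by move=> f'; rewrite B''E /pairing_val wE scale_lfunE subrr.
Qed.

(** * Non-zero pairings and the coend *)

Section Coend.
Variable cp : forall (V : vectType k) (M : C), copower V M.

(** By the universal property of the copower, [j X] amounts to a linear map from [dual (Hom I X)] to
    [Hom X N], which is [fam j]. *)
Let fam N (j : forall X, Hom (nakayama_integrand cp I X X) N) X (xi : dual (Hom I X)) :
  Hom X N := j X \c cp_unit (cp (dual (Hom I X)) X) xi.

(** Cowedges thus become natural maps from [dual (Hom I X)] to [Hom X N]; both sides are compared on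
    the copower units. *)
Lemma dinatural_nakayama N (j : forall X, Hom (nakayama_integrand cp I X X) N) :
  dinatural j <-> forall X Y (f : Hom X Y) (xi : dual (Hom I Y)),
    fam j (xi \o postcomp f)%VF = fam j xi \c f.
Proof.
have E X Y (f : Hom X Y) (xi : dual (Hom I Y)) :
  (j X \c bf_map (nakayama_integrand cp I) f (idm X)) \c cp_unit (cp _ X) xi =
    fam j (xi \o postcomp f)%VF.
  by rewrite -hcompA /= /nakayama_map cp_mapE transposeE hcompm1.
have E' X Y (f : Hom X Y) (xi : dual (Hom I Y)) :
  (j Y \c bf_map (nakayama_integrand cp I) (idm Y) f) \c cp_unit (cp _ X) xi =
    fam j xi \c f.
  rewrite -hcompA /= /nakayama_map cp_mapE transposeE hcompA.
  congr (fam j _ \c f); apply/lfunP=> u.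
  by rewrite comp_lfunE postcompE hcomp1m.
split=> [dj X Y f xi | nj X Y f]; first by rewrite -E -E' dj.
by apply: cp_homP => xi; rewrite E E' nj.
Qed.

(** The universal cowedge followed by [phi : alpha -> I] is a natural map [s] from [dual (Hom I X)]
    to [Hom X I]. It is bijective on projectives, and its inverse is the pairing. *)
Lemma pairing_of_coend alpha : is_nakayama cp I alpha -> isomorphic alpha I ->
  (exists P (u : Hom I P), projective P /\ u != 0) ->
  exists B : pairing, natural_pairing B /\ nonzero_pairing B.
Proof.
case=> i [/dinatural_nakayama i_nat i_univ] [phi [psi [psiK _]]] [P0 [u0 [hP0 u0N0]]].
pose s X xi := phi \c fam i xi : Hom X I.
have s_nat X Y (f : Hom X Y) xi : s X (xi \o postcomp f)%VF = s Y xi \c f.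
  by rewrite /s i_nat hcompA.
have s_lin X : linear (@s X).
  by move=> c xi xi'; rewrite /s /fam linearP hcomp_linearr /= hcomp_linearr.
(* [P] is a retract of a power of [G], so every [u : I -> P] is a sum of maps through [G]. It
   remains to see that [xi] vanishes on maps factoring through a given [u' : I -> G]. *)
have s_inj P xi : projective P -> s P xi = 0 -> xi = 0.
  move=> hP /(congr1 (fun f => psi \c f)); rewrite /s hcompA psiK hcomp1m hcomp0r => i0.
  have [G [_ G_gen _ [N [nu [nu_lin nu_inj nu_nat]]]]] := finite_abelian_generator finC.
  have [n [T [io [p [e [_ ip e_epi]]]]]] := generator_cover P G_gen.
  have [sg sgE] := hP _ _ _ (idm P) e_epi.
  apply/lfunP=> u; rewrite zero_lfunE.
  have -> : u = \sum_j (e \c io j) \c (p j \c (sg \c u)).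
    rewrite -{1}[u]hcomp1m -sgE -{1}[e]hcompm1 -ip hcomp_sumr !hcomp_suml.
    by apply: eq_bigr => j _; rewrite !hcompA.
  rewrite linear_sum big1 // => j _.
  set u' := p j \c _.
  (* This cowedge restricts functionals along [u'] to [Hom G X] and applies the injective [nu]. It
     factors through the coend, where [xi] is already zero. *)
  pose jj X : Hom (nakayama_integrand cp I X X) N :=
    cp_inv (cp (dual (Hom I X)) X)
      (linfun (fun xi : dual (Hom I X) => nu X (xi \o precomp u')%VF)).
  have jj_lin X : linear (fun xi : dual (Hom I X) => nu X (xi \o precomp u')%VF).
    by move=> c x y; rewrite -nu_lin; congr nu; rewrite comp_lfunDl comp_lfunZl.
  have jjE X xi' : fam jj xi' = nu X (xi' \o precomp u')%VF.
    by rewrite /fam -cp_homE cp_invK (linfun_linear (jj_lin X)).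
  have [|h [hE _]] := i_univ N jj.
    apply/dinatural_nakayama => X Y f xi'; rewrite !jjE -nu_nat; congr nu.
    by apply/lfunP=> v; rewrite !comp_lfunE !precompE !postcompE hcompA.
  have : fam jj xi = 0 by rewrite /fam -hE -hcompA [_ \c cp_unit _ _]i0 hcomp0r.
  rewrite jjE => /nu_inj/lfunP/(_ (e \c io j)).
  by rewrite comp_lfunE precompE zero_lfunE.
have [xi0 xi0u] := dual_separates u0N0.
have g0N0 : s P0 xi0 != 0.
  by apply: contra xi0u => /eqP/(s_inj _ _ hP0) ->; rewrite zero_lfunE.
(* The non-zero map [s P0 xi0] to the simple [I] is epi, so [g] lifts through it, and naturality
   turns the lift into a functional. *)
have s_surj Q (hQ : projective Q) g : exists xi, s Q xi = g.
  have [a aE] := hQ _ _ _ g (nonzero_to_simple_epi g0N0).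
  by exists (xi0 \o postcomp a)%VF; rewrite s_nat.
have sE X xi : linfun (@s X) xi = s X xi by exact: (linfun_linear (@s_lin X)).
pose B : pairing := fun P _ => (linfun (@s P))^-1%VF.
have sB P (hP : projective P) g : s P (B P hP g) = g.
  rewrite -sE limg_lfunVK //; have [xi <-] := s_surj P hP g.
  by rewrite -sE memv_img ?memvf.
have Bs P (hP : projective P) xi : B P hP (s P xi) = xi.
  apply/eqP; rewrite -subr_eq0; apply/eqP/(s_inj P) => //.
  by rewrite -sE linearB /= !sE sB subrr.
exists B; split; last by exists P0, hP0, (s P0 xi0), u0; rewrite /pairing_val Bs.
move=> P Q hP hQ a g f; rewrite /pairing_val -{1}(sB Q hQ g) -s_nat Bs.
by rewrite comp_lfunE postcompE.
Qed.

(** The inverse [r] of the pairing is natural on projectives. Descended along epimorphisms [e X]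
    from projectives, it becomes a cowedge with vertex [I] on the whole category, which is shown to
    be universal. *)
Lemma coend_of_pairing B : natural_pairing B -> nonzero_pairing B ->
  is_nakayama cp I I.
Proof.
move=> B_nat B_neq0; pose r := pairing_inv B.
have r_nat := pairing_inv_nat B_nat B_neq0.
have cov X : {P : C & {e : Hom P X | projective P /\ is_epi e}}.
  have [P /constructive_indefinite_description] :=
    constructive_indefinite_description _ (enough_projectives X).
  by exists P.
pose P X := projT1 (cov X); pose e X : Hom (P X) X := sval (projT2 (cov X)).
have hP X : projective (P X) by have [] := svalP (projT2 (cov X)).
have e_epi X : is_epi (e X) by have [] := svalP (projT2 (cov X)).
(* By naturality of [r], a map [a] from a projective with [e X \c a = 0] is also killed by [r] of
   the pulled-back functional. *)
have desc X (xi : dual (Hom I X)) :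
    {h : Hom X I | h \c e X = r _ (hP X) (xi \o postcomp (e X))%VF}.
  apply: constructive_indefinite_description; apply: epi_descent => // Q a hQ ea.
  rewrite -(r_nat _ _ hQ); suff -> : ((xi \o postcomp (e X)) \o postcomp a)%VF = 0.
    by rewrite linear0.
  apply/lfunP=> u; rewrite !comp_lfunE !postcompE hcompA ea hcomp0l zero_lfunE.
  by rewrite linear0.
pose s X xi := sval (desc X xi).
have sE X Q (hQ : projective Q) (q : Hom Q X) xi : s X xi \c q = r _ hQ (xi \o postcomp q)%VF.
  have [a aE] := hQ _ _ _ q (@e_epi X).
  rewrite -aE hcompA (svalP (desc X xi)) -(r_nat _ _ hQ); congr (r _ _ _).
  by apply/lfunP=> u; rewrite !comp_lfunE !postcompE hcompA.
have s_nat X Y (f : Hom X Y) xi : s X (xi \o postcomp f)%VF = s Y xi \c f.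
  apply: (@e_epi X); rewrite -hcompA !(sE _ _ (hP X)); congr (r _ _ _).
  by apply/lfunP=> u; rewrite !comp_lfunE !postcompE hcompA.
have s_lin X : linear (@s X).
  move=> c xi xi'; apply: (@e_epi X); rewrite hcomp_linearl !(sE _ _ (hP X)).
  by rewrite -linearP comp_lfunDl comp_lfunZl.
pose i X : Hom (nakayama_integrand cp I X X) I :=
  cp_inv (cp (dual (Hom I X)) X) (linfun (@s X)).
have iE X xi : fam i xi = s X xi.
  by rewrite /fam -cp_homE cp_invK (linfun_linear (@s_lin X)).
exists i; split; first by apply/dinatural_nakayama => X Y f xi; rewrite !iE.
move=> N j /dinatural_nakayama j_nat.
(* The functional [xi0] corresponds to [e I] under the pairing. A factorization [h] of [j] must
   therefore satisfy [h \c e I = fam j xi0], which gives uniqueness; descent along [e I] gives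
   existence. *)
have [xi0 xi0E] : exists xi, r _ (hP I) xi = e I.
  by exists (B _ (hP I) (e I)); apply: pairing_Kinv.
have [h hE] : exists h : Hom I N, h \c e I = fam j xi0.
  apply: epi_descent => // Q a hQ ea; rewrite -j_nat.
  suff -> : (xi0 \o postcomp a)%VF = 0 by rewrite /fam linear0 hcomp0r.
  rewrite -(pairing_invK B_nat B_neq0 hQ (xi0 \o _)%VF).
  by rewrite [pairing_inv _ _ _](r_nat _ _ hQ (hP I)) xi0E ea linear0.
have hs X xi : h \c s X xi = fam j xi.
  apply: (@e_epi X); rewrite -hcompA (sE _ _ (hP X)) -j_nat.
  set xi' := (xi \o _)%VF.
  have [a aE] := hP X _ _ _ (r _ (hP X) xi') (@e_epi I).
  rewrite -aE hcompA hE -j_nat; congr (fam j _).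
  apply: (can_inj (pairing_invK B_nat B_neq0 (hP X))).
  by rewrite (r_nat _ _ _ (hP I)) xi0E.
exists h; split=> [X | h' h'E].
  by apply: cp_homP => xi; rewrite -hcompA [_ \c cp_unit _ _]iE hs.
have eE : e I = s (P I) xi0.
  rewrite -[RHS]hcompm1 (sE _ _ (hP I)) -xi0E; congr (r _ _ _).
  by apply/lfunP=> u; rewrite comp_lfunE postcompE hcomp1m.
by apply: (@e_epi I); rewrite hE eE -iE /fam hcompA h'E.
Qed.
End Coend.

Lemma coend_iff_pairing : (exists P (u : Hom I P), projective P /\ u != 0) ->
  (exists (cp : forall (V : vectType k) (M : C), copower V M) (alpha : C),
     is_nakayama cp I alpha /\ isomorphic alpha I) <->
  (exists B : pairing, natural_pairing B /\ nonzero_pairing B).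
Proof.
move=> hP0; split=> [[cp [alpha [nak iso]]] | [B [B_nat B_neq0]]].
  exact: pairing_of_coend nak iso hP0.
exists (fun V M => epsilon (finite_abelian_copower finC V M) (fun=> True)), I.
split; first exact: coend_of_pairing B_nat B_neq0.
by exists (idm I), (idm I); rewrite hcomp1m.
Qed.
End Pairings.

(** * Arrows of a strict monoidal category *)

Reserved Notation "g \p f" (at level 40, left associativity).
Reserved Notation "f \t g" (at level 39, left associativity).

Section PackedArrows.
Variables (k : fieldType) (C : tensorcat k).
Implicit Types X Y Z : C.

(* Morphisms with their source and target forgotten, and [None] for an undefined
   composite: associativity and unit laws become Leibniz equalities and [eqhom]
   becomes an identity. *)
Record arrow := Arrow { asrc : C; atgt : C; amor : Hom asrc atgt }.

Definition pk X Y (f : Hom X Y) : option arrow := Some (Arrow f).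
Definition pI X := pk (idm X).

Definition pcomp (g f : option arrow) : option arrow :=
  match g, f with
  | Some g, Some f =>
    match excluded_middle_informative (atgt f = asrc g) with
    | left e => Some (Arrow (amor g \c eqhom e \c amor f))
    | right _ => None
    end
  | _, _ => None
  end.
Definition ptens (f g : option arrow) : option arrow :=
  match f, g with
  | Some f, Some g => Some (Arrow (amor f \om amor g))
  | _, _ => None
  end.
Local Notation "g \p f" := (pcomp g f).
Local Notation "f \t g" := (ptens f g).

Lemma pk_inj X Y (f g : Hom X Y) : pk f = pk g -> f = g.
Proof.
(* [tr] brings a packed arrow back to [Hom X Y]; by proof irrelevance the chosen equalities of
   endpoints do not matter. *)
pose tr (a : arrow) (e : asrc a = X) (e' : atgt a = Y) : Hom X Y :=
  eqhom e' \c amor a \c eqhom (esym e).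
have trE (a b : arrow) : a = b -> forall e e' i i', tr a e e' = tr b i i'.
  by move=> -> e e' i i'; rewrite /tr (eqhom_irr e' i') (eqhom_irr (esym e) (esym i)).
move=> /(congr1 (odflt (Arrow f)))/= /trE/(_ erefl erefl erefl erefl).
by rewrite /tr /= !hcomp1m !hcompm1.
Qed.

Lemma pkM X Y Z (g : Hom Y Z) (f : Hom X Y) : pk (g \c f) = pk g \p pk f.
Proof.
rewrite /pcomp /=; case: excluded_middle_informative => // e.
by rewrite (eqhom_irr e erefl) hcompm1.
Qed.

Lemma pk_eql X Y Z (e : Y = Z) (f : Hom X Y) : pk (eqhom e \c f) = pk f.
Proof. by subst Z; rewrite hcomp1m. Qed.
Lemma pk_eqr X Y Z (e : X = Y) (f : Hom Y Z) : pk (f \c eqhom e) = pk f.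
Proof. by subst Y; rewrite hcompm1. Qed.
Lemma pk_eq X Y (e : X = Y) : pk (eqhom e) = pI X.
Proof. by subst Y. Qed.

Lemma pkT X X' Y Y' (f : Hom X X') (g : Hom Y Y') : pk (f \om g) = pk f \t pk g.
Proof. by []. Qed.

Lemma pcompA h g f : h \p (g \p f) = h \p g \p f.
Proof.
case: h g f => [[X Y h]|] [[X' Y' g]|] [[X'' Y'' f]|] //=.
all: repeat (case: excluded_middle_informative => /=); try by [].
- move=> e1 e2 e3; by rewrite (eqhom_irr e3 e1) !hcompA.
all: by move=> *; congruence.
Qed.

Lemma ptensA f g h : f \t (g \t h) = f \t g \t h.
Proof.
case: f g h => [[X Y f]|] [[X' Y' g]|] [[X'' Y'' h]|] //=.
rewrite -![Some _]/(pk _) -(pk_eqr (tensA (tc_struct C) _ _ _)).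
by rewrite -tensmA pk_eql.
Qed.

Lemma pI1t f : pI (unit_ob C) \t f = f.
Proof.
case: f => [[X Y f]|] //=; rewrite -![Some _]/(pk _).
by rewrite -(pk_eql (tens1X (tc_struct C) _)) tensm1f pk_eqr.
Qed.
Lemma ptI1 f : f \t pI (unit_ob C) = f.
Proof.
case: f => [[X Y f]|] //=; rewrite -![Some _]/(pk _).
by rewrite -(pk_eql (tensX1 (tc_struct C) _)) tensmf1 pk_eqr.
Qed.

Lemma pIt X Y : pI (X \ox Y) = pI X \t pI Y.
Proof. by rewrite -pkT tensm1. Qed.

Lemma pI_l X Y (f : Hom X Y) : pI Y \p pk f = pk f.
Proof. by rewrite -pkM hcomp1m. Qed.
Lemma pI_r X Y (f : Hom X Y) : pk f \p pI X = pk f.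
Proof. by rewrite -pkM hcompm1. Qed.
Lemma pII X : pI X \p pI X = pI X.
Proof. exact: pI_l. Qed.

Lemma pcomp_defined g f : g \p f <> None ->
  exists X Y Z (g0 : Hom Y Z) (f0 : Hom X Y), g = pk g0 /\ f = pk f0.
Proof.
case: g f => [[Y Z g]|] [[X Y' f]|] //=.
case: excluded_middle_informative => //= e _; subst Y.
by exists X, Y', Z, g, f.
Qed.

(** Definedness of both composites is required: tensor products of objects may coincide although the
    factors differ. *)
Lemma ptensM f' f g' g : f' \p f <> None -> g' \p g <> None ->
  (f' \t g') \p (f \t g) = (f' \p f) \t (g' \p g).
Proof.
move=> /pcomp_defined[X [Y [Z [f1 [f0 [-> ->]]]]]].
move=> /pcomp_defined[X' [Y' [Z' [g1 [g0 [-> ->]]]]]].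
by rewrite -!pkT -!pkM -pkT tensmM.
Qed.

Lemma ptensMr X f g : g \p f <> None -> pI X \t (g \p f) = (pI X \t g) \p (pI X \t f).
Proof. by move=> d; rewrite ptensM ?pII. Qed.
Lemma ptensMl X f g : g \p f <> None -> (g \p f) \t pI X = (g \t pI X) \p (f \t pI X).
Proof. by move=> d; rewrite ptensM ?pII. Qed.

Lemma pslide X X' Y Y' (f : Hom X X') (g : Hom Y Y') :
  (pk f \t pI Y') \p (pI X \t pk g) = pk f \t pk g.
Proof. by rewrite ptensM ?pI_l ?pI_r. Qed.
Lemma pslide' X X' Y Y' (f : Hom X X') (g : Hom Y Y') :
  (pI X' \t pk g) \p (pk f \t pI Y) = pk f \t pk g.
Proof. by rewrite ptensM ?pI_l ?pI_r. Qed.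
End PackedArrows.
Notation "g \p f" := (pcomp g f).
Notation "f \t g" := (ptens f g).

(** [pack] erases associators and unitors from a typed composite; [defined] shows that a packed
    composite exists by reading it as the packing of one typed morphism. *)
Ltac pack :=
  repeat first [rewrite pk_eql | rewrite pk_eqr | rewrite pkM | rewrite pkT | rewrite pk_eq];
  rewrite -?/(pI _).
Ltac defined := by rewrite -?pkT -?pkM.

(** * Dual pairs and the bending of strands *)

Section DualPairs.
Variables (k : fieldType) (C : tensorcat k).
Implicit Types X Y Z L A B : C.
Local Notation "1" := (unit_ob C).

Section OnePair.
Variables (L X : C) (e : Hom (L \ox X) 1) (c : Hom 1 (X \ox L)).
Hypothesis eP : dual_pair e c.

Lemma psnakel : (pI X \t pk e) \p (pk c \t pI X) = pI X.
Proof.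
have := congr1 (@pk _ _ _ _) (proj1 eP).
by rewrite /runit /assoc /lunitV; pack.
Qed.
Lemma psnaker : (pk e \t pI L) \p (pI L \t pk c) = pI L.
Proof.
have := congr1 (@pk _ _ _ _) (proj2 eP).
by rewrite /lunit /assocV /runitV; pack.
Qed.

(** Closing with [e] undoes bending with [c], by a snake identity. This gives
    [Hom X B = Hom 1 (B \ox L)]; the variants below give [Hom L B = Hom 1 (X \ox B)] and
    [Hom A L = Hom (A \ox X) 1]. *)
Lemma coev_curry B (u : Hom X B) :
  pk u = (pI B \t pk e) \p (pk ((u \om idm L) \c c) \t pI X).
Proof.
rewrite pkM pkT ptensMl -?pkT -?pkM // pkM.
rewrite !pkT -/(pI L) -!ptensA -pIt pcompA pslide' -pslide ptI1 -pcompA.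
by rewrite psnakel pI_r.
Qed.

Lemma coev_curry_inj B (u v : Hom X B) : (u \om idm L) \c c = (v \om idm L) \c c -> u = v.
Proof. by move=> uv; apply: pk_inj; rewrite coev_curry uv -coev_curry. Qed.

Lemma coev_curry_surj B (w : Hom 1 (B \ox L)) :
  exists u : Hom X B, (u \om idm L) \c c = w.
Proof.
pose u := runit B \c (idm B \om e) \c assoc B L X \c (w \om idm X) \c lunitV X.
have uE : pk u = (pI B \t pk e) \p (pk w \t pI X).
  by rewrite /u /runit /assoc /lunitV; pack.
exists u; apply: pk_inj; rewrite pkM pkT uE ptensMl -?uE // -!ptensA -pIt.
rewrite -pcompA -{1}[pk c]pI1t pslide -pslide' ptI1 pcompA pIt -ptensA.
by rewrite -ptensMr psnaker // -pIt pI_l.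
Qed.

Lemma coev_curryl B (u : Hom L B) :
  pk u = (pk e \t pI B) \p (pI L \t pk ((idm X \om u) \c c)).
Proof.
rewrite pkM pkT ptensMr -?pkT -?pkM // pkM.
rewrite !pkT -/(pI X) !ptensA -pIt pcompA pslide -pslide' pI1t -pcompA.
by rewrite psnaker pI_r.
Qed.

Lemma coev_curryl_inj B (u v : Hom L B) : (idm X \om u) \c c = (idm X \om v) \c c -> u = v.
Proof. by move=> uv; apply: pk_inj; rewrite coev_curryl uv -coev_curryl. Qed.

Lemma coev_curryl_surj B (w : Hom 1 (X \ox B)) :
  exists u : Hom L B, (idm X \om u) \c c = w.
Proof.
pose u := lunit B \c (e \om idm B) \c assocV L X B \c (idm L \om w) \c runitV L.
have uE : pk u = (pk e \t pI B) \p (pI L \t pk w).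
  by rewrite /u /lunit /assocV /runitV; pack.
exists u; apply: pk_inj; rewrite pkM pkT uE ptensMr -?uE // !ptensA -pIt.
rewrite -pcompA -{1}[pk c]ptI1 pslide' -pslide pI1t pcompA pIt ptensA.
by rewrite -ptensMl psnakel // -pIt pI_l.
Qed.

Lemma ev_curry A (u : Hom A L) :
  pk u = (pk (e \c (u \om idm X)) \t pI L) \p (pI A \t pk c).
Proof.
rewrite pkM pkT ptensMl -?pkT -?pkM // pkM !pkT -/(pI X) -!ptensA -pIt.
rewrite -pcompA pslide -(pslide' u c) ptI1 pcompA.
by rewrite psnaker pI_l.
Qed.

Lemma ev_curry_inj A (u v : Hom A L) : e \c (u \om idm X) = e \c (v \om idm X) -> u = v.
Proof. by move=> uv; apply: pk_inj; rewrite ev_curry uv -ev_curry. Qed.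

Lemma ev_curry_surj A (w : Hom (A \ox X) 1) :
  exists u : Hom A L, e \c (u \om idm X) = w.
Proof.
pose u := lunit L \c (w \om idm L) \c assocV A X L \c (idm A \om c) \c runitV A.
have uE : pk u = (pk w \t pI L) \p (pI A \t pk c).
  by rewrite /u /lunit /assocV /runitV; pack.
exists u; apply: pk_inj; rewrite pkM pkT uE ptensMl -?uE // -!ptensA -pIt.
rewrite pcompA -{1}[pk e]pI1t pslide' -pslide ptI1 -pcompA pIt -ptensA.
by rewrite -ptensMr psnakel // -pIt pI_r.
Qed.

(** Inserting the snake identity of [c'] in front of [c] and straightening with the other snake
    identity of [c] leaves [c']. *)
Lemma coev_unique (c' : option (arrow C)) (c0 : Hom 1 (X \ox L)) : c' = pk c0 ->
  (pI X \t pk e) \p (c' \t pI X) = pI X -> c' = pk c.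
Proof.
move=> c'E s1.
have : ((pI X \t pk e) \p (c' \t pI X)) \t pI L \p pk c = pk c.
  by rewrite s1 -pIt pI_l.
move=> <-; rewrite ptensMl ?s1 // -!ptensA -pIt -pcompA -{1}[pk c]pI1t.
rewrite c'E pslide -pslide' ptI1 pcompA pIt -ptensA.
by rewrite -ptensMr psnaker // -pIt pI_l.
Qed.
End OnePair.
End DualPairs.

(** * Rigid categories *)

Section RigidCategory.
Variables (k : fieldType) (C : tensorcat k) (D : rigid_structure C).
Implicit Types X Y Z P Q : C.
Local Notation "1" := (unit_ob C).
Local Notation "X ^v" := (ldual D X) (at level 2, format "X ^v").

Lemma tensm0l X X' Y Y' (g : Hom Y Y') : (0 : Hom X X') \om g = 0.
Proof. by rewrite -(linfun_linear (@tensm_linearl _ _ (tc_struct C) X X' _ _ g)) linear0. Qed.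
Lemma tensm0r X X' Y Y' (f : Hom X X') : f \om (0 : Hom Y Y') = 0.
Proof. by rewrite -(linfun_linear (@tensm_linearr _ _ (tc_struct C) _ _ Y Y' f)) linear0. Qed.

Lemma coev_ldual_map X Y (f : Hom X Y) :
  (idm Y \om ldual_map D f) \c coev D Y = (f \om idm X^v) \c coev D X.
Proof.
have [u uE] := coev_curryl_surj (ldualP D Y) ((f \om idm X^v) \c coev D X).
rewrite -uE; congr ((_ \om _) \c _); apply: pk_inj.
rewrite (coev_curryl (ldualP D Y) u) uE /ldual_map /lunit /assocV /runitV.
by pack.
Qed.

Lemma ev_ldual_map X Y (f : Hom X Y) :
  ev D X \c (ldual_map D f \om idm X) = ev D Y \c (idm Y^v \om f).
Proof.
have [u uE] := ev_curry_surj (ldualP D X) (ev D Y \c (idm Y^v \om f)).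
rewrite -uE; congr (_ \c (_ \om _)); apply: pk_inj.
rewrite (ev_curry (ldualP D X) u) uE /ldual_map /lunit /assocV /runitV.
pack; rewrite ptensMr; last by defined.
rewrite ptensMl; last by defined.
by rewrite !ptensA pcompA.
Qed.

Lemma pk_evM X Y :
  pk (ev D (X \ox Y)) = pk (ev D Y) \p (pI Y^v \t (pk (ev D X) \t pI Y)).
Proof.
rewrite evM /lunit /assoc /assocV; pack.
have -> : pI (X \ox Y)^v \t pI (X \ox Y) = pI (Y^v \ox (X^v \ox X \ox Y)).
  by rewrite ldualM !pIt !ptensA.
by rewrite -pcompA -!pkT pI_r.
Qed.

(** Strictness of duality is imposed on evaluations only. The nested coevaluation satisfies a snake
    identity with [ev D (X \ox Y)], so it is the coevaluation by uniqueness. *)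
Lemma pk_coevM X Y : pk (coev D (X \ox Y)) =
  (pI X \t pk (coev D Y) \t pI X^v) \p pk (coev D X).
Proof.
have e : X \ox 1 \ox X^v = X \ox X^v by rewrite tensX1.
have e' : X \ox (Y \ox Y^v) \ox X^v = X \ox Y \ox (X \ox Y)^v.
  by rewrite ldualM !tensA.
apply/esym.
apply: (@coev_unique _ _ _ _ _ _ (ldualP D (X \ox Y)) _
  (eqhom e' \c (idm X \om coev D Y \om idm X^v) \c eqhom (esym e) \c coev D X)).
  by pack.
have dP : (pI X \t pk (coev D Y) \t pI X^v) \p pk (coev D X) =
    pk ((idm X \om coev D Y \om idm X^v) \c eqhom (esym e) \c coev D X) by pack.
rewrite pk_evM ptensMl; last by rewrite dP.
rewrite ptensMr; last by rewrite -pk_evM.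
(* The coevaluation of [Y] and the evaluation of [X] act on different strands; exchanging them
   separates the two snakes. *)
have mid : (pI (X \ox Y) \t (pI Y^v \t (pk (ev D X) \t pI Y))) \p
    (pI X \t pk (coev D Y) \t pI X^v \t pI (X \ox Y)) =
    (pI X \t (pk (coev D Y) \t pI Y)) \p (pI X \t (pk (ev D X) \t pI Y)).
  transitivity (pI X \t (pk (coev D Y) \t pk (ev D X)) \t pI Y).
    rewrite -pslide' ptensMr; last by defined.
    rewrite ptensMl; last by defined.
    by rewrite !pIt !ptensA.
  rewrite -ptensA -pslide ptensMl; last by defined.
  by rewrite ptensMr ?ptI1 ?pI1t //; defined.
rewrite pcompA -(pcompA (pI (X \ox Y) \t pk (ev D Y))) mid.
rewrite pcompA -pcompA !pIt.
have -> : (pI X \t pI Y \t pk (ev D Y)) \p (pI X \t (pk (coev D Y) \t pI Y)) =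
    pI X \t pI Y.
  by rewrite -ptensA -ptensMr psnakel //; apply: ldualP.
have -> : (pI X \t (pk (ev D X) \t pI Y)) \p (pk (coev D X) \t (pI X \t pI Y)) =
    pI X \t pI Y.
  by rewrite !ptensA -ptensMl psnakel //; apply: ldualP.
by rewrite -pIt pII.
Qed.

(* Hom(P^*, -) = Hom(1, P (x) -), and epimorphisms split after tensoring with P. *)
Lemma projective_ldual P : projective P -> projective P^v.
Proof.
move=> hP X Y e f e_epi.
have [sg sgE] : exists sg, (idm P \om e) \c sg = idm (P \ox Y).
  apply: (@projective_tensr _ _ D P Y hP); exact: epi_tensl (rdualP D P) e_epi.
have [g gE] := coev_curryl_surj (ldualP D P) (sg \c ((idm P \om f) \c coev D P)).
exists g; apply: (coev_curryl_inj (ldualP D P)).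
by rewrite tensmMr -hcompA gE hcompA sgE hcomp1m.
Qed.

(** Bending turns [f] and [f'] into maps [g] and [g'] from [P^v] and [Q^v] to the unit. As [g] is
    epi and [Q^v] projective, [g'] lifts through [g], and [a] is the map whose transpose is the lift
    [al]. *)
Lemma extension_from_unit : (forall X (f : Hom X 1), f != 0 -> is_epi f) ->
  forall P Q (f : Hom 1 P) (f' : Hom 1 Q), projective Q -> f != 0 ->
  exists a : Hom P Q, f' = a \c f.
Proof.
move=> nz_epi P Q f f' hQ f0.
have [g gE] := coev_curryl_surj (ldualP D P) (runitV P \c f).
have [g' g'E] := coev_curryl_surj (ldualP D Q) (runitV Q \c f').
have g0 : g != 0.
  apply: contra f0 => /eqP g0.
  rewrite -[f]hcomp1m -(eqhomVK (esym (tensX1 (tc_struct C) P))) -hcompA.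
  by rewrite [_ \c f](esym gE) g0 tensm0r hcomp0l hcomp0r.
have [al alE] := projective_ldual hQ g' (nz_epi _ _ g0).
have [a aE] := coev_curry_surj (ldualP D P) ((idm Q \om al) \c coev D Q).
exists a; apply: pk_inj.
transitivity (pk (runitV Q \c f')); first by rewrite /runitV pk_eql.
rewrite -g'E -alE tensmMr -hcompA -aE hcompA -tensmM hcomp1m hcompm1.
have -> : a \om g = (a \om idm 1) \c (idm P \om g) by rewrite -tensmM hcomp1m hcompm1.
rewrite -hcompA gE /runitV; pack.
by rewrite ptI1.
Qed.
End RigidCategory.

(** * Modified traces *)

Section RightTraces.
Variables (k : closedFieldType) (C : pivotal_ftc k).
Local Notation D := (ftc_rigid C).
Local Notation p := (pftc_piv C).
Local Notation "1" := (unit_ob C).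
Local Notation "X ^v" := (ldual D X) (at level 2, format "X ^v").
Implicit Types (X Y M : C) (P Q : Proj C) (t : trace_family C).

Let finC : finite_abelian C := ftc_finite C.
Let simple1 : is_simple 1 := ftc_simple C.

(** The pivotal evaluation, which makes [X^v] a right dual of [X]. *)
Definition piv_ev X : Hom (X \ox X^v) 1 := ev D X^v \c (piv p X \om idm X^v).

Lemma piv_ev_nat X Y (g : Hom X Y) :
  piv_ev Y \c (g \om idm Y^v) = piv_ev X \c (idm X \om ldual_map D g).
Proof.
rewrite /piv_ev -hcompA -tensmMl piv_nat tensmMl hcompA ev_ldual_map -!hcompA.
by rewrite -!tensmM !hcomp1m !hcompm1.
Qed.

Lemma piv_evM X Y : pk (piv_ev (X \ox Y)) =
  pk (piv_ev X) \p (pI X \t pk (piv_ev Y) \t pI X^v).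
Proof.
have pM : pk (piv p (X \ox Y)) = pk (piv p X) \t pk (piv p Y).
  by rewrite -(pk_eql (lddualM D X Y)) pivM.
have evE Z : pk (piv_ev Z) = pk (ev D Z^v) \p (pk (piv p Z) \t pI Z^v).
  by rewrite /piv_ev pkM pkT.
rewrite [LHS]evE pM ldualM pk_evM !pIt -pcompA.
have -> : (pI (lddual D X) \t (pk (ev D Y^v) \t pI X^v)) \p
    (pk (piv p X) \t pk (piv p Y) \t (pI Y^v \t pI X^v)) =
    pk (piv p X) \t pk (piv_ev Y) \t pI X^v.
  rewrite -!ptensA [pk (piv p Y) \t _]ptensA ptensM ?pI_l //.
    by rewrite -ptensMl -?evE.
  by rewrite -!pkT -pkM.
rewrite (evE X) -pcompA; congr (_ \p _).
by rewrite -{2}[pk (piv p X)]ptI1 -ptensMl ?pslide.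
Qed.

Definition projr_ldual P X : projective (P \ox X^v) := @prP _ _ (projr P X^v).
Arguments projr_ldual : clear implicits.

(** The right partial trace with the pivotal map absorbed into the evaluation, so that it applies to
    endomorphisms of [P \ox X]. *)
Definition partial_trace (P X : C) (f : Hom (P \ox X) (P \ox X)) : Hom P P :=
  runit P \c (idm P \om piv_ev X) \c assoc P X X^v \c (f \om idm X^v)
    \c assocV P X X^v \c (idm P \om coev D X) \c runitV P.

Lemma pk_partial_trace (P X : C) (f : Hom (P \ox X) (P \ox X)) :
  pk (partial_trace f) =
  (pI P \t pk (piv_ev X)) \p (pk f \t pI X^v) \p (pI P \t pk (coev D X)).
Proof. by rewrite /partial_trace /runit /assoc /assocV /runitV; pack. Qed.

Lemma right_partial_traceE (P X : C) (f : Hom (P \ox X) (P \ox lddual D X)) :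
  right_partial_trace f = partial_trace ((idm P \om pivV p X) \c f).
Proof.
apply: pk_inj; rewrite pk_partial_trace /right_partial_trace.
rewrite /runit /assoc /assocV /runitV; pack; congr (_ \p _).
rewrite /piv_ev; pack; rewrite ptensMr; last by defined.
rewrite ptensMl; last by defined.
rewrite !ptensA pcompA -[_ \p _ \p (pI P \t pk (pivV p X) \t _)]pcompA.
rewrite -ptensMl; last by defined.
rewrite -ptensMr; last by defined.
by rewrite -pkM pivVK -/(pI _) -pIt -pcompA -ptensMl ?pI_l.
Qed.

(** Composition with the invertible [idm P \om pivV p X] passes between the two kinds of arguments
    [f]. *)
Lemma right_modifiedP t : right_modified_trace t <-> is_trace t /\
  forall P X (f : Hom (P \ox X) (P \ox X)), t P (partial_trace f) = t (projr P X) f.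
Proof.
split=> -[tr tm]; split=> // P X f; last by rewrite right_partial_traceE tm.
have fE : f = (idm P \om pivV p X) \c ((idm P \om piv p X) \c f).
  by rewrite hcompA -tensmM hcomp1m pivK tensm1 hcomp1m.
by rewrite [in RHS]fE -tm right_partial_traceE -fE.
Qed.

(** The evaluation of [P \ox X] closes the inner strand [X] first, so it factors as [piv_ev P \c a].
    Naturality moves [a] to the coevaluation side, where it closes [f] to its partial trace. *)
Lemma pairing_partial_trace (B : pairing 1) (P X : C)
    (f : Hom (P \ox X) (P \ox X)) (h1 : projective (P \ox X \ox (P \ox X)^v))
    (h2 : projective (P \ox P^v)) : natural_pairing B ->
  pairing_val B h1 (piv_ev (P \ox X)) ((f \om idm (P \ox X)^v) \c coev D (P \ox X)) =
  pairing_val B h2 (piv_ev P) ((partial_trace f \om idm P^v) \c coev D P).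
Proof.
move=> B_nat.
have e : P \ox X \ox (P \ox X)^v = P \ox (X \ox X^v) \ox P^v by rewrite ldualM !tensA.
have [a aE] : exists a : Hom (P \ox X \ox (P \ox X)^v) (P \ox P^v),
    pk a = pI P \t pk (piv_ev X) \t pI P^v.
  exists (((runit P \c (idm P \om piv_ev X)) \om idm P^v) \c eqhom e).
  by rewrite /runit; pack.
have -> : piv_ev (P \ox X) = piv_ev P \c a.
  by apply: pk_inj; rewrite piv_evM pkM aE.
rewrite (B_nat _ _ h1 h2); congr (pairing_val _ _ _ _); apply: pk_inj.
rewrite pkM aE 2!pkM !pkT pk_partial_trace pk_coevM ldualM -?/(pI _).
rewrite ptensMl -?pk_partial_trace // ptensMl; last first.
  move=> d; have := erefl (pk (partial_trace f)).
  by rewrite {1}pk_partial_trace d.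
by rewrite !pIt !ptensA !pcompA.
Qed.

Definition trace_of_pairing (B : pairing 1) : trace_family C :=
  fun P => linfun (fun f : Hom P P =>
    pairing_val B (projr_ldual P P) (piv_ev P) ((f \om idm P^v) \c coev D P) : k^o).

Lemma trace_of_pairingE B P f : trace_of_pairing B P f =
  pairing_val B (projr_ldual P P) (piv_ev P) ((f \om idm P^v) \c coev D P).
Proof.
apply: (linfun_linear (f := fun f : Hom P P =>
  pairing_val B (projr_ldual P P) (piv_ev P) ((f \om idm P^v) \c coev D P) : k^o)).
by move=> c u v; rewrite tensm_linearl hcomp_linearl /pairing_val linearP.
Qed.

Section OfPairing.
Variable B : pairing 1.
Hypothesis B_nat : natural_pairing B.

(** The map [g] travels around the loop: the coevaluation turns it into its transpose, naturality of
    [B] carries the transpose to the other argument, and the pivotal evaluation turns it back into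
    [g]. *)
Lemma trace_of_pairing_comp P M (f : Hom M P) (g : Hom P M) :
  trace_of_pairing B P (f \c g) = pairing_val B (projr_ldual P M)
    (piv_ev M \c (g \om idm M^v)) ((f \om idm M^v) \c coev D M).
Proof.
rewrite trace_of_pairingE tensmMl -hcompA -coev_ldual_map piv_ev_nat.
rewrite (B_nat _ (projr_ldual P P)); congr (pairing_val _ _ _ _).
by rewrite !hcompA -!tensmM !hcomp1m !hcompm1.
Qed.

Lemma trace_of_pairing_right_modified : right_modified_trace (trace_of_pairing B).
Proof.
apply/right_modifiedP; split=> [P Q f g | P X f].
  rewrite trace_of_pairing_comp trace_of_pairingE (B_nat _ (projr_ldual Q Q)).
  by rewrite hcompA -tensmMl.
by rewrite !trace_of_pairingE; apply/esym/pairing_partial_trace.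
Qed.

Hypothesis B_neq0 : nonzero_pairing B.

Let extension (P Q : C) (f : Hom 1 P) (f' : Hom 1 Q) :
  projective Q -> f != 0 -> exists a : Hom P Q, f' = a \c f.
Proof.
by apply: (extension_from_unit D); apply: nonzero_to_simple_epi.
Qed.

Lemma trace_of_pairing_nondegenerate : nondegenerate_trace (trace_of_pairing B).
Proof.
move=> M P; split=> [f f0 | g g0].
  suff fc : (f \om idm M^v) \c coev D M = 0.
    by apply: (coev_curry_inj (ldualP D M)); rewrite fc tensm0l hcomp0l.
  apply: (pairing_nondegr extension B_nat B_neq0 (hP := projr_ldual P M)).
  (* Bending [w] and composing with the inverse pivotal map writes [w] as
     [piv_ev M \c (g \om idm M^v)] for some [g : P -> M]. *)
  move=> w; have [u uE] := ev_curry_surj (ldualP D M^v) w.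
  rewrite -uE -[u]hcomp1m -(pivVK p) -hcompA tensmMl hcompA -/(piv_ev M).
  by rewrite -trace_of_pairing_comp f0.
suff gc : piv_ev M \c (g \om idm M^v) = 0.
  rewrite -[g]hcomp1m -(pivK p) -hcompA.
  suff -> : piv p M \c g = 0 by rewrite hcomp0r.
  apply: (ev_curry_inj (ldualP D M^v)); rewrite tensmMl hcompA -/(piv_ev M) gc.
  by rewrite tensm0l hcomp0r.
apply: (pairing_nondegl finC simple1 B_nat B_neq0 (hP := projr_ldual P M)).
move=> w; have [f <-] := coev_curry_surj (ldualP D M) w.
by rewrite -trace_of_pairing_comp g0.
Qed.
End OfPairing.

Definition pairing_of_trace t : pairing 1 := fun (P : C) hP =>
  linfun (fun g : Hom P 1 =>
    linfun (fun f : Hom 1 P => t (MkProj hP) (f \c g) : k^o) : dual (Hom 1 P)).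

Lemma pairing_of_traceE t (P : C) (hP : projective P) g f :
  pairing_val (pairing_of_trace t) hP g f = t (MkProj hP) (f \c g).
Proof.
have lf (g' : Hom P 1) : linear (fun f : Hom 1 P => t (MkProj hP) (f \c g') : k^o).
  by move=> c u v; rewrite hcomp_linearl linearP.
have lg : linear (fun g : Hom P 1 =>
    linfun (fun f : Hom 1 P => t (MkProj hP) (f \c g) : k^o) : dual (Hom 1 P)).
  move=> c u v; apply/lfunP=> f'; rewrite add_lfunE scale_lfunE !(linfun_linear (lf _)).
  by rewrite hcomp_linearr linearP.
by rewrite /pairing_val (linfun_linear lg) (linfun_linear (lf g)).
Qed.

Lemma pairing_of_trace_natural t : is_trace t -> natural_pairing (pairing_of_trace t).
Proof.
move=> tr P Q hP hQ a g f.
by rewrite !pairing_of_traceE hcompA (tr (MkProj hP) (MkProj hQ)) hcompA.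
Qed.

(** Straightening the loop yields [g \c y \c piv p P] for a fixed map [y] from the double dual to
    [P]; a left inverse of [y] then suffices to solve for [g]. *)
Lemma rank_one_partial_trace (P : C) (w : Hom P P) :
  exists g : Hom P P,
    w = partial_trace (((g \om idm P^v) \c coev D P) \c piv_ev P).
Proof.
pose Q := lddual D P.
(* [y : Q -> P] and [y' : P -> Q] are the maps whose transposes are [piv p P^v] and its inverse. *)
have [y yE] := coev_curry_surj (ldualP D Q) ((idm P \om piv p P^v) \c coev D P).
have [y' y'E] := coev_curry_surj (ldualP D P) ((idm Q \om pivV p P^v) \c coev D Q).
have y'y : y' \c y = idm Q.
  apply: (coev_curry_inj (ldualP D Q)).
  rewrite tensmMl -hcompA yE hcompA -tensmM hcomp1m hcompm1.
  have -> : y' \om piv p P^v = (idm Q \om piv p P^v) \c (y' \om idm P^v).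
    by rewrite -tensmM hcomp1m hcompm1.
  by rewrite -hcompA y'E hcompA -tensmM hcomp1m pivVK tensm1 hcomp1m.
(* The same [y] in the shape in which it appears inside the partial trace over [P^v]. *)
have ypk : pk y = (pI P \t pk (piv_ev P^v)) \p (pk (coev D P) \t pI Q).
  rewrite (coev_curry (ldualP D Q) y) yE pkM pkT.
  rewrite ptensMl; last by defined.
  rewrite -?/(pI _) -!ptensA pcompA -ptensMr; last by defined.
  by rewrite -pkT -pkM.
pose g := w \c pivV p P \c y'.
suff gE : partial_trace (((g \om idm P^v) \c coev D P) \c piv_ev P) = g \c y \c piv p P.
  exists g; rewrite gE /g -!hcompA (hcompA y' y) y'y hcomp1m pivK hcompm1.
  by [].
apply: pk_inj; rewrite pk_partial_trace !(pkM _ (piv p P)) pkM.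
rewrite [pk (_ \c y)]pkM (ev_curry (ldualP D P^v) (piv p P)) -/(piv_ev P) ypk.
rewrite [pk (_ \c coev D P)]pkM pkT -?/(pI _).
rewrite ptensMl; last by defined.
rewrite ptensMl; last by defined.
have sl : (pI P \t pk (piv_ev P^v)) \p (pk g \t pI P^v \t pI Q) =
    pk g \p (pI P \t pk (piv_ev P^v)).
  by rewrite -ptensA -pIt pslide' -pslide ptI1.
by rewrite !pcompA sl.
Qed.

Lemma right_trace_determined t : right_modified_trace t ->
  (forall (P : C) (hP : projective P) g f, pairing_val (pairing_of_trace t) hP g f = 0) ->
  forall P f, t P f = 0.
Proof.
move=> /right_modifiedP[_ tm] t0 P f; have [g ->] := rank_one_partial_trace f.
have := t0 _ (projr_ldual P P) (piv_ev P) ((g \om idm P^v) \c coev D P).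
by rewrite tm pairing_of_traceE.
Qed.

(** For a projective [P] covering the unit, [coev D P] is non-zero: otherwise [P] would vanish, and
    with it the unit. *)
Lemma nonzero_projective_morphism : exists (P : C) (u : Hom 1 P), projective P /\ u != 0.
Proof.
have [P [e [hP e_epi]]] := enough_projectives finC 1.
exists (P \ox P^v), (coev D P); split; first exact: (@projr_ldual (MkProj hP) P).
apply/eqP => c0; case: simple1 => + _; apply.
have P0 : idm P = 0.
  by apply: (coev_curry_inj (ldualP D P)); rewrite c0 !hcomp0r.
by apply: e_epi; rewrite hcomp0l hcomp1m -[e]hcompm1 P0 hcomp0r.
Qed.

Lemma unimodular_iff_pairing : unimodular C <->
  exists B : pairing 1, natural_pairing B /\ nonzero_pairing B.
Proof.
apply: coend_iff_pairing => //; last exact: nonzero_projective_morphism.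
move=> P Q f f' hQ f0.
by apply: (extension_from_unit D) => //; apply: nonzero_to_simple_epi.
Qed.

Lemma right_modified_comb t t' c (u : trace_family C) :
  (forall P f, u P f = t P f - c * t' P f) ->
  right_modified_trace t -> right_modified_trace t' -> right_modified_trace u.
Proof.
move=> uE [tr tm] [tr' tm']; split=> [P Q f g | P X f]; rewrite !uE.
  by rewrite (tr P Q) (tr' P Q).
by rewrite tm tm'.
Qed.

Lemma right_modified_pairing_neq0 t : right_modified_trace t -> nonzero_trace t ->
  nonzero_pairing (pairing_of_trace t).
Proof.
move=> rt [P [f tf]]; apply: NNPP => nz; case/eqP: tf.
apply: right_trace_determined => // Q hQ g h.
by apply/eqP/negPn/negP => ne; apply: nz; exists Q, hQ, g, h.
Qed.

Lemma right_modified_unique t0 t : right_modified_trace t0 -> nonzero_trace t0 ->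
  right_modified_trace t -> exists c : k, forall P f, t P f = c * t0 P f.
Proof.
move=> rt0 nt0 rt.
have ext (P Q : C) (f : Hom 1 P) (f' : Hom 1 Q) :
    projective Q -> f != 0 -> exists a : Hom P Q, f' = a \c f.
  by apply: (extension_from_unit D) => //; apply: nonzero_to_simple_epi.
have [c cE] := pairing_unique finC simple1 ext
  (pairing_of_trace_natural (proj1 rt0)) (right_modified_pairing_neq0 rt0 nt0)
  (pairing_of_trace_natural (proj1 rt)).
exists c => P f; apply/eqP; rewrite -subr_eq0; apply/eqP.
pose u : trace_family C := fun P => (t P - c *: t0 P : 'Hom(Hom P P, k^o)).
have uE Q g : u Q g = t Q g - c * t0 Q g.
  by rewrite /u add_lfunE opp_lfunE scale_lfunE.
rewrite -uE; apply: right_trace_determined; first exact: right_modified_comb uE rt rt0.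
by move=> Q hQ g h; rewrite pairing_of_traceE uE -!pairing_of_traceE cE subrr.
Qed.

Lemma trace_of_pairing_neq0 (B : pairing 1) : natural_pairing B -> nonzero_pairing B ->
  nonzero_trace (trace_of_pairing B).
Proof.
move=> B_nat B_neq0; have [P [hP [g [f gf]]]] := B_neq0.
have f0 : f != 0 by apply: contra gf => /eqP ->; rewrite /pairing_val linear0.
apply: NNPP => nz; case/eqP: f0.
have [nd _] := @trace_of_pairing_nondegenerate B B_nat B_neq0 1 (MkProj hP).
apply: (nd f) => h.
by apply/eqP/negPn/negP => ne; apply: nz; exists (MkProj hP), (f \c h).
Qed.

Theorem right_modified_traces :
  (unimodular C <-> exists t, right_modified_trace t /\ nonzero_trace t) /\
  (unimodular C -> has_dim (@right_modified_trace k C) 1 /\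
    forall t, right_modified_trace t -> nonzero_trace t -> nondegenerate_trace t).
Proof.
split.
  split=> [/unimodular_iff_pairing[B [B_nat B_neq0]] | [t [rt nt]]].
    exists (trace_of_pairing B); split; first exact: trace_of_pairing_right_modified.
    exact: trace_of_pairing_neq0.
  apply/unimodular_iff_pairing; exists (pairing_of_trace t); split.
    exact: pairing_of_trace_natural (proj1 rt).
  exact: right_modified_pairing_neq0.
move=> /unimodular_iff_pairing[B [B_nat B_neq0]].
pose t0 := trace_of_pairing B.
have rt0 : right_modified_trace t0 by exact: trace_of_pairing_right_modified.
have nt0 : nonzero_trace t0 by exact: trace_of_pairing_neq0.
split.
  exists (fun=> t0); split=> [t | c c0 i].
    split=> [/(right_modified_unique rt0 nt0)[c cE] | [c cE]].
      by exists (fun=> c) => P f; rewrite big_ord1 cE.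
    (* The multiple [c * t0] is the difference [t0 - (1 - c) * t0], the form that
       [right_modified_comb] accepts. *)
    apply: (@right_modified_comb t0 t0 (1 - c ord0)) => // P f.
    by rewrite cE big_ord1 mulrBl mul1r subKr.
  have [P [f t0f]] := nt0; have := c0 P f; rewrite big_ord1 [i]ord1 => /eqP.
  by rewrite mulf_eq0 => /orP[/eqP // | t0f0]; case/negP: t0f.
(* Here [t0] is written as a multiple of [t], so that whatever [t] pairs to zero is also paired to
   zero by the non-degenerate [t0]. *)
move=> t rt nt; have [c cE] := right_modified_unique rt nt rt0.
move=> M P; have [nd nd'] := @trace_of_pairing_nondegenerate B B_nat B_neq0 M P.
split=> [f f0 | g g0]; [apply: nd | apply: nd'] => h; rewrite -/t0 cE ?f0 ?g0 mulr0 //.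
Qed.
End RightTraces.

(** * The reversed tensor product *)

Section ReversedTensor.
Variables (k : fieldType) (C : tensorcat k).
Let T := tc_struct C.

Lemma rev_tensmA (X X' Y Y' Z Z' : C) (f : Hom X X') (g : Hom Y Y') (h : Hom Z Z') :
  eqhom (esym (tensA T Z' Y' X')) \c (h \om (g \om f)) =
  ((h \om g) \om f) \c eqhom (esym (tensA T Z Y X)).
Proof. by apply: pk_inj; rewrite pk_eql pk_eqr !pkT ptensA. Qed.

Definition rev_structure : tensor_structure C := @TensorStructure k C
  (one T) (fun X Y => tens T Y X) (fun X X' Y Y' f g => tensm T g f)
  (fun X X' Y Y' g => @tensm_linearr k C T Y Y' X X' g)
  (fun X X' Y Y' f => @tensm_linearl k C T Y Y' X X' f)
  (fun X Y => tensm1 T Y X)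
  (fun X X' X'' Y Y' Y'' f' f g' g => tensmM T g' g f' f)
  (fun X Y Z => esym (tensA T Z Y X)) (tensX1 T) (tens1X T)
  rev_tensmA (@tensmf1 k C T) (@tensm1f k C T).

Definition rev_tensorcat : tensorcat k := TensorCat rev_structure.

(** Reversal exchanges the two snake identities, so left and right duals trade places. *)
Lemma rev_dual_pair (L X : C) (e : Hom (L \ox X) (unit_ob C)) (c : Hom (unit_ob C) (X \ox L)) :
  dual_pair e c -> @dual_pair k rev_tensorcat X L e c.
Proof.
case=> h1 h2; split; rewrite /runit /lunit /assoc /assocV /lunitV /runitV /= ?esymK.
  exact: h2.
exact: h1.
Qed.

Variable D : rigid_structure C.

Lemma rev_evM (X Y : C) :
  ev' D (Y \ox X) =
    ev' D Y \c ((runit Y \c (idm Y \om ev' D X)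
        \c eqhom (esym (esym (tensA T Y X (rdual D X))))) \om idm (rdual D Y))
      \c assocV (Y \ox X) (rdual D X) (rdual D Y)
      \c (idm (Y \ox X) \om eqhom (rdualM D Y X)).
Proof. by rewrite esymK; exact: ev'M. Qed.

Lemma rev_ev'M (X Y : C) :
  ev D (Y \ox X) =
    ev D X \c (idm (ldual D X) \om (lunit X \c (ev D Y \om idm X) \c assocV _ Y X))
      \c eqhom (esym (esym (tensA T (ldual D X) (ldual D Y) (Y \ox X))))
      \c (eqhom (ldualM D Y X) \om idm (Y \ox X)).
Proof. by rewrite esymK; exact: evM. Qed.

Definition rev_rigid : rigid_structure rev_tensorcat := @RigidStructure k rev_tensorcat
  (rdual D) (ev' D) (coev' D) (fun X => rev_dual_pair (rdualP D X))
  (ldual D) (ev D) (coev D) (fun X => rev_dual_pair (ldualP D X))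
  (rdual1 D) (ev'1 D) (fun X Y => rdualM D Y X) rev_evM
  (ldual1 D) (ev1 D) (fun X Y => ldualM D Y X) rev_ev'M
  (lrdual D) (ev_rdual D) (rldual D) (ev'_ldual D).
End ReversedTensor.

(** * The pivotal structure of the reversed category *)

Section ReversedPivotal.
Variables (k : closedFieldType) (C : pivotal_ftc k).
Local Notation D := (ftc_rigid C).
Local Notation p := (pftc_piv C).
Local Notation R := (rev_rigid D).
Implicit Types X Y : C.

(** The rigid structure makes the dualities mutually inverse on objects and evaluations; for
    morphisms this follows because both sides slide through the same evaluation. *)
Lemma pk_ldual_rdual_map X Y (f : Hom X Y) :
  pk (ldual_map D (@ldual_map k _ R X Y f)) = pk f.
Proof.
rewrite -(pk_eql (lrdual D Y)) -(pk_eqr (lrdual D X) f).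
congr (pk _); apply: (ev_curry_inj (rdualP D Y)).
have rev_map : ev' D X \c (idm X \om (@ldual_map k _ R X Y f : Hom (rdual D Y) (rdual D X))) =
    ev' D Y \c (f \om idm (rdual D Y)).
  exact: (@ev_ldual_map k _ R X Y f).
move: (@ldual_map k _ R X Y f : Hom (rdual D Y) (rdual D X)) rev_map => g rev_map.
move: (ldual_map D g) (ev_ldual_map D g) => h hE.
rewrite !tensmMl !hcompA -(ev_rdual D Y) hE ev_rdual -rev_map.
by rewrite -!hcompA -!tensmM !hcomp1m !hcompm1.
Qed.

Lemma pk_ldual_map (X Y X' Y' : C) (f : Hom X Y) (g : Hom X' Y') :
  pk f = pk g -> pk (ldual_map D f) = pk (ldual_map D g).
Proof.
move=> /(congr1 (odflt (Arrow f)))/= fg.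
exact: (congr1 (fun a : arrow C => pk (ldual_map D (amor a))) fg).
Qed.

Lemma pk_lddual_rddual_map X Y (f : Hom X Y) :
  pk (lddual_map D (@lddual_map k _ R X Y f)) = pk f.
Proof.
rewrite /lddual_map -[RHS]pk_ldual_rdual_map; apply: pk_ldual_map.
exact: pk_ldual_rdual_map.
Qed.

Lemma pivV_nat X Y (f : Hom X Y) : f \c pivV p X = pivV p Y \c lddual_map D f.
Proof.
rewrite -[LHS]hcomp1m -(pivK p) -(hcompA (pivV p Y)); congr (_ \c _).
by rewrite hcompA piv_nat -hcompA pivVK hcompm1.
Qed.

(** Double left duals in the reversed category are double right duals in [C], so the pivotal map is
    the inverse of [piv_rddual X]. *)
Definition rev_piv X : Hom X (rddual D X) :=
  pivV p (rddual D X) \c eqhom (esym (lrddual D X)).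

Lemma rev_pivK X : piv_rddual X \c rev_piv X = idm X.
Proof.
apply: pk_inj; rewrite /piv_rddual /rev_piv -hcompA pk_eql hcompA pivVK pkM.
by rewrite pk_eq -/(pI _) -(pI_r (idm _)) lrddual.
Qed.

Lemma rev_pivVK X : rev_piv X \c piv_rddual X = idm (rddual D X).
Proof.
apply: pk_inj; rewrite /piv_rddual /rev_piv pkM pk_eqr pk_eql.
by rewrite -pkM pivK.
Qed.

Lemma rev_piv_nat X Y (f : Hom X Y) :
  rev_piv Y \c f = (@lddual_map k _ R X Y f : Hom (rddual D X) (rddual D Y)) \c rev_piv X.
Proof.
apply: pk_inj; set f'' : Hom (rddual D X) (rddual D Y) := lddual_map R _.
rewrite /rev_piv (hcompA f'') pk_eqr pivV_nat [RHS]pkM.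
by rewrite pk_lddual_rddual_map pkM pk_eqr.
Qed.

Lemma pk_pivV1 : pk (pivV p (unit_ob C)) = pI (unit_ob C).
Proof.
have p1 : pk (piv p (unit_ob C)) = pI (unit_ob C).
  by rewrite -(pk_eql (lddual1 D)) piv1.
have e : pI (lddual D (unit_ob C)) = pI (unit_ob C) by rewrite lddual1.
by rewrite -[LHS]pI_r e -{1}p1 -pkM pivK.
Qed.

Lemma rddual1 : rddual D (unit_ob C) = unit_ob C.
Proof. by rewrite /rddual !rdual1. Qed.

Lemma rddualM X Y : rddual D (X \ox Y) = rddual D X \ox rddual D Y.
Proof. by rewrite /rddual !rdualM. Qed.

Lemma pk_pivVM X Y : pk (pivV p (X \ox Y)) = pk (pivV p X) \t pk (pivV p Y).
Proof.
have pM : pk (piv p (X \ox Y)) = pk (piv p X) \t pk (piv p Y).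
  by rewrite -(pk_eql (lddualM D X Y)) pivM.
have := congr1 (@pk _ _ _ _) (pivK p (X \ox Y)); rewrite pkM pM => e.
have eI : pI (lddual D (X \ox Y)) = pI (lddual D X) \t pI (lddual D Y).
  by rewrite lddualM pIt.
rewrite -[LHS]pI_r eI /pI -!(pivVK p) !pkM -ptensM; [|defined..].
by rewrite pcompA e -!pkT pI_l.
Qed.

(** Transparent, so that its inverse map unfolds to the [piv_rddual] of the left modified trace
    condition. *)
Definition rev_pivotal : pivotal_structure R.
Proof.
apply: (@PivotalStructure k _ R rev_piv (@piv_rddual k C) rev_pivK rev_pivVK rev_piv_nat).
  apply: (@pk_inj k C); rewrite [LHS](@pk_eql k C) /rev_piv pk_eqr.
  exact: (etrans (congr1 (fun Z => pk (pivV p Z)) rddual1) pk_pivV1).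
move=> X Y; apply: (@pk_inj k C); rewrite [LHS](@pk_eql k C) [RHS](@pkT k C).
rewrite /rev_piv !pk_eqr.
exact: (etrans (congr1 (fun Z => pk (pivV p Z)) (rddualM Y X)) (pk_pivVM _ _)).
Defined.

Definition rev_ftc : finite_tensor_category k :=
  @FiniteTensorCategory k (rev_tensorcat C) (ftc_finite C) R (ftc_simple C).
Definition rev_pivotal_ftc : pivotal_ftc k := @PivotalFTC k rev_ftc rev_pivotal.
End ReversedPivotal.

(** * Left modified traces by reversal *)

Section LeftTraces.
Variables (k : closedFieldType) (C : pivotal_ftc k).
Local Notation D := (ftc_rigid C).
Local Notation Cr := (rev_pivotal_ftc C).

(** Projectivity does not involve the tensor product, so only the record around the object
    changes. *)
Definition to_rev (t : trace_family C) : trace_family Cr :=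
  fun P => t (@MkProj k C P (@prP _ _ P)).
Definition of_rev (t : trace_family Cr) : trace_family C :=
  fun P => t (@MkProj k Cr P (@prP _ _ P)).

Lemma to_revK (t : trace_family Cr) (P : Proj Cr) (f : Hom P P) :
  to_rev (of_rev t) P f = t P f.
Proof. by case: P f. Qed.

(** A family takes the projectivity proof as an argument, and the two categories prove projectivity
    of a tensor product differently. *)
Lemma trace_family_irr (E : pivotal_ftc k) (t : trace_family E) (P : E)
    (h h' : projective P) (f : Hom P P) : t (MkProj h) f = t (MkProj h') f.
Proof. by rewrite (proof_irrelevance _ h h'). Qed.

Lemma left_partial_traceE (P X : C) (f : Hom (X \ox P) (rddual D X \ox P)) :
  left_partial_trace f = @right_partial_trace k Cr P X f.
Proof.
rewrite /left_partial_trace /right_partial_trace /assoc /assocV /lunit /runit.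
by rewrite /lunitV /runitV /= !esymK.
Qed.

Lemma left_modified_rev t : left_modified_trace t <-> right_modified_trace (to_rev t).
Proof.
split=> -[tr tm]; split.
- by move=> P Q f g; exact: (tr (@MkProj k C P (@prP _ _ P)) (@MkProj k C Q (@prP _ _ Q)) f g).
- move=> P X f; rewrite /to_rev -left_partial_traceE.
  rewrite (tm (@MkProj k C P (@prP _ _ P)) X f).
  exact: trace_family_irr.
- by move=> [P hP] [Q hQ] f g; exact: (tr (@MkProj k Cr P hP) (@MkProj k Cr Q hQ) f g).
move=> [P hP] X f; rewrite left_partial_traceE.
apply: etrans (tm (@MkProj k Cr P hP) X f) _.
exact: trace_family_irr.
Qed.

Lemma left_of_rev (u : trace_family Cr) :
  right_modified_trace u -> left_modified_trace (of_rev u).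
Proof.
move=> [tr tm]; apply/left_modified_rev; split=> [P Q f g | P X f].
  by rewrite !to_revK (tr P Q).
by rewrite !to_revK tm.
Qed.

Lemma to_rev_nonzero t : nonzero_trace t -> nonzero_trace (to_rev t).
Proof. by case=> [[P hP] [f tf]]; exists (@MkProj k Cr P hP), f. Qed.

Lemma of_rev_nonzero (u : trace_family Cr) : nonzero_trace u -> nonzero_trace (of_rev u).
Proof. by case=> [[P hP] [f tf]]; exists (@MkProj k C P hP), f. Qed.

Theorem left_modified_traces :
  (unimodular C <-> exists t : trace_family C, left_modified_trace t /\ nonzero_trace t) /\
  (unimodular C -> has_dim (@left_modified_trace k C) 1 /\
    forall t : trace_family C,
      left_modified_trace t -> nonzero_trace t -> nondegenerate_trace t).
Proof.
have [[R1 R2] R3] := right_modified_traces Cr.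
split.
  split=> [/R1[u [ru nu]] | [t [lt nt]]].
    by exists (of_rev u); split; [exact: left_of_rev | exact: of_rev_nonzero].
  apply: R2; exists (to_rev t); split; last exact: to_rev_nonzero.
  exact/left_modified_rev.
move=> /R3[[b [bT b_free]] nd]; split.
  exists (fun i => of_rev (b i)); split=> [t | c c0].
    split=> [/left_modified_rev/bT[c cE] | [c cE]].
      by exists c => -[P hP] f; apply: (cE (@MkProj k Cr P hP) f).
    apply/left_modified_rev/bT; exists c => -[P hP] f.
    exact: (cE (@MkProj k C P hP) f).
  by apply: b_free => -[P hP] f; apply: (c0 (@MkProj k C P hP) f).
move=> t /left_modified_rev rt /to_rev_nonzero nt M [P hP].
exact: (nd _ rt nt M (@MkProj k Cr P hP)).
Qed.
End LeftTraces.

Theorem theorem6p8 (k : closedFieldType) (C : pivotal_ftc k) :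
  [/\ unimodular C <->
        exists t : trace_family C, right_modified_trace t /\ nonzero_trace t,
      unimodular C <->
        exists t : trace_family C, left_modified_trace t /\ nonzero_trace t
    & unimodular C ->
      [/\ has_dim (@right_modified_trace k C) 1,
          has_dim (@left_modified_trace k C) 1
        & forall t : trace_family C,
            right_modified_trace t \/ left_modified_trace t ->
            nonzero_trace t -> nondegenerate_trace t]].
Proof.
have [r1 r2] := right_modified_traces C; have [l1 l2] := left_modified_traces C.
split=> // uni; have [r3 r4] := r2 uni; have [l3 l4] := l2 uni.
by split=> // t [rt | lt]; [exact: r4 | exact: l4].
Qed.
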